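(* Let $t_0=0$. For $i=1,\dots,n$ and $t\in(t_{i-1},t_i]$ define the bounded linear operator $L_t:H\to\mathbb R^{m_i^+}$ by $$L_t:=\begin{bmatrix}LS_{t_i-t}\\ LS_{t_{i+1}-t}\\ \vdots\\ LS_{t_n-t}\end{bmatrix},$$ and define $R_t\in\mathbb R^{m_i^+\times m_i^+}$ and $\alpha_t\in\mathbb R^{m_i^+}$ by the backward recursions $$R_t:=\begin{cases}\Sigma+LQ_{t_n-t}L^*, & i=n,\\[1mm] \begin{bmatrix}\Sigma&0\\0&R^+_{t_i}\end{bmatrix}+L_{t_i}Q_{t_i-t}L_{t_i}^*, & i<n,\end{cases}\qquad \alpha_t:=\begin{cases}L\int_t^{t_n}S_{t_n-s}a_s\,ds, & i=n,\\[1mm] \begin{bmatrix}0\\ \alpha^+_{t_i}\end{bmatrix}+L_{t_i}\int_t^{t_i}S_{t_i-s}a_s\,ds, & i<n,\end{cases}$$ where $R^+_{t_i}:=\lim_{s\downarrow t_i}R_s$ and $\alpha^+_{t_i}:=\lim_{s\downarrow t_i}\alpha_s$. Then the function $g$ defined in the context is given, for all $x\in H$ and $i=1,\dots,n$, by $$g(t,x)=f(y_i^+;\,L_tx+\alpha_t,\,R_t),\qquad t\in(t_{i-1},t_i].$$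
   Context: $H$ is a Hilbert space, $A$ generates a strongly continuous semigroup $(S_t)_{t\ge0}$ on $H$, $Q$ is a symmetric, positive, trace class operator on $H$, and $W$ is a cylindrical Wiener process on $H$, defined on a stochastic basis $(\Omega,\mathcal F,(\mathcal F_t)_{t\ge0},\mathbb P)$. $(a_t)_{t\ge0}$ is a predictable $H$-valued process with integrable trajectories. $Z$ is the Ornstein–Uhlenbeck process given as the unique mild solution of $dZ_t=[AZ_t+a_t]dt+Q^{1/2}dW_t$, $Z_0\sim\nu_0$, with $\nu_0$ a Gaussian measure on $H$. Its transition kernel is $\nu_{s,t}(x,B):=\mathbb P(Z_t\in B\mid Z_s=x)$ for $0\le s\le t$, $x\in H$, $B\subset H$ Borel; $\nu_{s,t}(x,\cdot)$ is the Gaussian measure on $H$ with mean $S_{t-s}x+\int_s^tS_{t-u}a_u\,du$ and covariance operator $Q_{t-s}$, where $Q_r:=\int_0^rS_uQS_u^*\,du$. Observation times $0<t_1<\dots<t_n=T$; $L:H\to\mathbb R^m$ bounded linear with adjoint $L^*$; $\Sigma\in\mathbb R^{m\times m}$ a positive definite (covariance) matrix; $f(\cdot;b,C)$ denotes the Gaussian density with mean $b$ and covariance matrix $C$; $k(x,y):=f(y;Lx,\Sigma)$. Fixed observations $y_1,\dots,y_n\in\mathbb R^m$; $y_i^+:=(y_i,\dots,y_n)\in\mathbb R^{m_i^+}$ with $m_i^+:=(n-i+1)m$. The function $g$ is defined for $t\in(t_{i-1},t_i]$, $x\in H$, by $$g(t,x):=\int k(x_{t_i},y_i)\Big(\prod_{j=i}^{n-1}k(x_{t_{j+1}},y_{j+1})\,\nu_{t_j,t_{j+1}}(x_{t_j},dx_{t_{j+1}})\Big)\nu_{t,t_i}(x,dx_{t_i}),$$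 with the convention $g(0,x):=\lim_{s\downarrow0}g(s,x)$. *)

(* Defs.v *)
From HB Require Import structures.
From mathcomp Require Import all_boot all_order all_algebra.
From mathcomp Require Import all_classical all_reals all_analysis.

Set Implicit Arguments.
Unset Strict Implicit.
Unset Printing Implicit Defensive.

Import Order.TTheory GRing.Theory Num.Theory.
Import numFieldNormedType.Exports.

Local Open Scope classical_set_scope.
Local Open Scope ring_scope.

(** A real Hilbert space is a [completeNormedModType R] together with a
    positive definite symmetric form [ip : {dot H for idfun}] inducing its norm. *)
Definition induces_norm (R : realType) (H : completeNormedModType R)
    (ip : {dot H for idfun}) : Prop :=
  forall x : H, ip x x = `|x| ^+ 2.

Definition borel (T : ptopologicalType) := g_sigma_algebraType (@open T).

(** ** Operators *)

Definition cvdot (R : realType) (d : nat) (u v : 'cV[R]_d) : R :=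
  (u^T *m v) 0 0.

(** For a bounded [M] between Hilbert spaces the vector below exists (Riesz) and
    is unique. *)
Definition adjoint (R : realType) (V W : pointedType) (ipV : V -> V -> R)
    (ipW : W -> W -> R) (M : V -> W) : W -> V :=
  fun y => get [set z : V | forall x : V, ipW (M x) y = ipV x z].

Definition orthonormal_basis (R : realType) (H : completeNormedModType R)
    (ip : {dot H for idfun}) (E : set H) : Prop :=
  [/\ forall e, E e -> ip e e = 1,
      forall e e', E e -> E e' -> e <> e' -> ip e e' = 0
    & forall x : H, (forall e, E e -> ip x e = 0) -> x = 0].

(** For a positive operator the trace does not depend on the basis. *)
Definition sym_pos_trace_class (R : realType) (H : completeNormedModType R)
    (ip : {dot H for idfun}) (Q : {linear H -> H}) : Prop :=
  [/\ continuous Q,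
      forall x y : H, ip (Q x) y = ip x (Q y),
      forall x : H, 0 <= ip (Q x) x
    & exists E : set H, orthonormal_basis ip E /\
        (\esum_(e in E) (ip (Q e) e)%:E < +oo)%E].

(** Only the operators [S t] with [0 <= t] are meaningful. *)
Definition C0_semigroup (R : realType) (H : completeNormedModType R)
    (S : R -> {linear H -> H}) : Prop :=
  [/\ forall t, 0 <= t -> continuous (S t),
      forall x, S 0 x = x,
      forall s t x, 0 <= s -> 0 <= t -> S (s + t) x = S s (S t x)
    & forall x, S h x @[h --> 0^'+] --> x].

(** [A], with domain [domA], is the infinitesimal generator of [S]. *)
Definition generates (R : realType) (H : completeNormedModType R)
    (domA : set H) (A : H -> H) (S : R -> {linear H -> H}) : Prop :=
  forall x y : H, domA x /\ A x = y <->
    (h^-1 *: (S h x - x) @[h --> 0^'+] --> y).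

(** ** Bochner integral *)

(** The list [:: (A_1, v_1); ..; (A_k, v_k)] stands for the simple function
    sum_i 1_(A_i) v_i ; the sets need not be disjoint. *)
Definition simple_fun (R : realType) (H : completeNormedModType R) (T : Type)
    (s : seq (set T * H)) (x : T) : H :=
  \sum_(p <- s) (\1_(p.1) x : R) *: p.2.

Definition simple_integral (d : measure_display) (T : measurableType d)
    (R : realType) (H : completeNormedModType R)
    (mu : {measure set T -> \bar R}) (D : set T) (s : seq (set T * H)) : H :=
  \sum_(p <- s) fine (mu (D `&` p.1)) *: p.2.

Definition is_bochner_integral (d : measure_display) (T : measurableType d)
    (R : realType) (H : completeNormedModType R)
    (mu : {measure set T -> \bar R}) (D : set T) (f : T -> H) (v : H) : Prop :=
  measurable_fun D (f : T -> borel H) /\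
  exists s : nat -> seq (set T * H),
    [/\ forall k p, p \in s k ->
          measurable p.1 /\ (mu (D `&` p.1) < +oo)%E,
        (\int[mu]_(x in D) (`|f x - simple_fun (s k) x|%R)%:E)%E @[k --> \oo]
          --> 0%E
      & simple_integral mu D (s k) @[k --> \oo] --> v].

Definition bochner_integrable (d : measure_display) (T : measurableType d)
    (R : realType) (H : completeNormedModType R)
    (mu : {measure set T -> \bar R}) (D : set T) (f : T -> H) : Prop :=
  exists v, is_bochner_integral mu D f v.

Definition bochner_integral (d : measure_display) (T : measurableType d)
    (R : realType) (H : completeNormedModType R)
    (mu : {measure set T -> \bar R}) (D : set T) (f : T -> H) : H :=
  get [set v | is_bochner_integral mu D f v].

(** ** Processes *)

Definition filtration (R : realType) (d : measure_display)
    (Omega : measurableType d) (F : R -> set (set Omega)) : Prop :=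
  [/\ forall t, 0 <= t -> sigma_algebra setT (F t),
      forall t, 0 <= t -> F t `<=` measurable
    & forall s t, 0 <= s -> s <= t -> F s `<=` F t].

Definition predictable_rectangles (R : realType) (Omega : Type)
    (F : R -> set (set Omega)) : set (set (R * Omega)) :=
  [set C | (exists2 A, F 0 A & C = [set 0] `*` A) \/
           (exists s t A, [/\ 0 <= s, s < t, F s A & C = `]s, t] `*` A])].

Definition predictable (R : realType) (Omega : Type)
    (F : R -> set (set Omega)) (H : completeNormedModType R)
    (a : R -> Omega -> H) : Prop :=
  let D := [set p : R * Omega | 0 <= p.1] in
  forall B : set (borel H), measurable B ->
    <<s D, predictable_rectangles F >> (D `&` [set p | B (a p.1 p.2)]).

(** ** Gaussian measures *)

(** The normal law with mean [m] and variance [v], a Dirac mass if [v = 0]. *)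
Definition normal_law (R : realType) (m v : R) : set R -> \bar R :=
  if v == 0 then \d_m else normal_prob m (Num.sqrt v).

(** The Gaussian measure with mean [m] and covariance operator [C]: every
    functional <., h> has law N(<m, h>, <C h, h>). *)
Definition gaussian_measure (R : realType) (H : completeNormedModType R)
    (ip : {dot H for idfun}) (mu : set (borel H) -> \bar R)
    (m : H) (C : H -> H) : Prop :=
  forall (h : H) (B : set R), measurable B ->
    mu [set x : borel H | B (ip (x : H) h)] = normal_law (ip m h) (ip (C h) h) B.

(** The finite-dimensional Gaussian density f(y; b, C). *)
Definition gauss_density (R : realType) (d : nat) (y b : 'cV[R]_d)
    (C : 'M[R]_d) : R :=
  expR (- (2^-1 * cvdot (y - b) (invmx C *m (y - b)))) /
  Num.sqrt ((2 * pi) ^+ d * \det C).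

Definition pos_def (R : realType) (d : nat) (C : 'M[R]_d) : Prop :=
  C^T = C /\ forall u : 'cV[R]_d, u != 0 -> 0 < cvdot u (C *m u).

(** ** The Ornstein-Uhlenbeck kernel *)

(** Q_r = \int_0^r S_u Q S_u^* du (strong integral). *)
Definition cov_int (R : realType) (H : completeNormedModType R)
    (ip : {dot H for idfun}) (S : R -> {linear H -> H}) (Q : {linear H -> H})
    (r : R) (h : H) : H :=
  bochner_integral (@lebesgue_measure R) `[0, r]
    (fun u => S u (Q (adjoint ip ip (S u) h))).

(** \int_s^t S_(t-u) a_u du for a trajectory [a]. *)
Definition drift_int (R : realType) (H : completeNormedModType R)
    (S : R -> {linear H -> H}) (a : R -> H) (s t : R) : H :=
  bochner_integral (@lebesgue_measure R) `[s, t] (fun u => S (t - u) (a u)).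

(** The law of Z_t given Z_s = x, where Z is the mild solution of
    dZ = (A Z + a) dt + Q^(1/2) dW and [a] is the drift trajectory, is the
    Gaussian measure with mean S_(t-s) x + \int_s^t S_(t-u) a_u du and covariance
    operator Q_(t-s). *)
Definition ou_kernel (R : realType) (H : completeNormedModType R)
    (ip : {dot H for idfun}) (S : R -> {linear H -> H}) (Q : {linear H -> H})
    (a : R -> H) (nu : R -> R -> R.-pker (borel H) ~> (borel H)) : Prop :=
  forall (s t : R) (x : H), 0 <= s -> s <= t ->
    gaussian_measure ip (nu s t x)
      (S (t - s) x + drift_int S a s t) (cov_int ip S Q (t - s)).

(** ** Observations and the function g

    [tau 0 = 0 < tau 1 < .. < tau n] are the observation times, with
    observation [y i] at time [tau i], 1 <= i <= n. Backward recursions over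
    i = n, n-1, .., 1 are indexed by [r = n - i]. *)

Definition obs_kernel (R : realType) (H : completeNormedModType R) (m : nat)
    (L : H -> 'cV[R]_m) (Sigma : 'M[R]_m) (x : H) (y : 'cV[R]_m) : R :=
  gauss_density y (L x) Sigma.

(** The iterated integral over x_(t_(i+1)), .., x_(t_n) of
    k(u, y_i) \prod_(j = i)^(n-1) k(x_(t_(j+1)), y_(j+1)), started from
    x_(t_i) = u, where i = n - r. *)
Fixpoint path_integral (R : realType) (H : completeNormedModType R) (m : nat)
    (L : H -> 'cV[R]_m) (Sigma : 'M[R]_m) (n : nat) (tau : nat -> R)
    (y : nat -> 'cV[R]_m) (nu : R -> R -> R.-pker (borel H) ~> (borel H))
    (r : nat) (u : borel H) : \bar R :=
  match r with
  | 0%N => (obs_kernel L Sigma u (y n))%:E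
  | r'.+1 =>
      ((obs_kernel L Sigma u (y (n - r'.+1)%N))%:E *
       \int[nu (tau (n - r'.+1)%N) (tau (n - r')%N) u]_v
         path_integral L Sigma n tau y nu r' v)%E
  end.

(** The least [i <= n] with [t <= tau i]: for [0 < t <= tau n] it is the [i] with
    tau (i-1) < t <= tau i. *)
Definition obs_index (R : realType) (n : nat) (tau : nat -> R) (t : R) : nat :=
  find (fun i => t <= tau i) (iota 0 n.+1).

Definition g_fun (R : realType) (H : completeNormedModType R) (m : nat)
    (L : H -> 'cV[R]_m) (Sigma : 'M[R]_m) (n : nat) (tau : nat -> R)
    (y : nat -> 'cV[R]_m) (nu : R -> R -> R.-pker (borel H) ~> (borel H))
    (t : R) (x : H) : \bar R :=
  let g s := let i := obs_index n tau s in
    (\int[nu s (tau i) x]_u path_integral L Sigma n tau y nu (n - i)%N u)%E in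
  if t == 0 then lim (g s @[s --> 0^'+]) else g t.

(** ** The quantities L_t, R_t, alpha_t *)

(** The dimension (n - i + 1) m = (r + 1) m, in a form that makes the block
    decompositions below typecheck. *)
Fixpoint dim_plus (m r : nat) : nat :=
  match r with 0%N => m | r'.+1 => (m + dim_plus m r')%N end.

Fixpoint y_plus (R : realType) (m n : nat) (y : nat -> 'cV[R]_m) (r : nat) :
    'cV[R]_(dim_plus m r) :=
  match r with
  | 0%N => y n
  | r'.+1 => col_mx (y (n - r'.+1)%N) (y_plus n y r')
  end.

Fixpoint L_op (R : realType) (H : completeNormedModType R)
    (S : R -> {linear H -> H}) (m : nat) (L : H -> 'cV[R]_m) (n : nat)
    (tau : nat -> R) (r : nat) (t : R) (x : H) : 'cV[R]_(dim_plus m r) :=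
  match r with
  | 0%N => L (S (tau n - t) x)
  | r'.+1 => col_mx (L (S (tau (n - r'.+1)%N - t) x)) (L_op S L n tau r' t x)
  end.

(** The matrix of M C M^* : R^d -> R^d. *)
Definition sandwich_mx (R : realType) (H : completeNormedModType R)
    (ip : {dot H for idfun}) (d : nat) (M : H -> 'cV[R]_d) (C : H -> H) :
    'M[R]_d :=
  \matrix_(p, q) M (C (adjoint ip (@cvdot R d) M (delta_mx q 0))) p 0.

(** [R_mx r t] is R_t for t in (tau (i-1), tau i], i = n - r. Right of [tau i]
    and close to it, R_s is given by [r' = n - (i+1)], whence the limit. *)
Fixpoint R_mx (R : realType) (H : completeNormedModType R)
    (ip : {dot H for idfun}) (S : R -> {linear H -> H}) (Q : {linear H -> H})
    (m : nat) (L : H -> 'cV[R]_m) (Sigma : 'M[R]_m) (n : nat) (tau : nat -> R)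
    (r : nat) (t : R) : 'M[R]_(dim_plus m r) :=
  match r with
  | 0%N => Sigma + sandwich_mx ip L (cov_int ip S Q (tau n - t))
  | r'.+1 =>
      let ti := tau (n - r'.+1)%N in
      (block_mx Sigma 0 0
         (lim (R_mx ip S Q L Sigma n tau r' s @[s --> ti^'+])) :
         'M[R]_(dim_plus m r'.+1)) +
      sandwich_mx ip (L_op S L n tau r'.+1 ti) (cov_int ip S Q (ti - t))
  end.

Fixpoint alpha_vec (R : realType) (H : completeNormedModType R)
    (S : R -> {linear H -> H}) (a : R -> H) (m : nat) (L : H -> 'cV[R]_m)
    (n : nat) (tau : nat -> R) (r : nat) (t : R) : 'cV[R]_(dim_plus m r) :=
  match r with
  | 0%N => L (drift_int S a t (tau n))
  | r'.+1 =>
      let ti := tau (n - r'.+1)%N in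
      (col_mx 0 (lim (alpha_vec S a L n tau r' s @[s --> ti^'+])) :
         'cV[R]_(dim_plus m r'.+1)) +
      L_op S L n tau r'.+1 ti (drift_int S a t ti)
  end.

(* Main.v *)
(* Integrating a finite-dimensional Gaussian density f(y; M u + b, P) against a
   Gaussian measure N(m, C) in u yields f(y; M m + b, P + M C M'), M' the adjoint
   of M: write the density as a Fourier integral of exp(- theta^T P theta / 2),
   exchange the integrals, and use that <u, M' theta> has a normal law, whose
   characteristic function multiplies the weight by exp(- <C M' theta, M' theta>
   / 2). Going backwards in i, the factor k(u, y_i) makes the integrand a density
   whose covariance is block diagonal, the block below Sigma being R at t_i; the
   semigroup law then turns L_(t_i) S_(t_i - t) into L_t. The limits in the
   recursions are the values at t_i because <Q_r h, k> and the drift integral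
   depend continuously on time; measurability of the adjoint orbits rests on the
   strong continuity of the adjoint semigroup. *)

Require Import Defs.
From HB Require Import structures.
From mathcomp Require Import all_boot all_order all_algebra.
From mathcomp Require Import all_classical all_reals all_analysis.
From mathcomp Require Import measurable_realfun ring lra.
Import Order.TTheory GRing.Theory Num.Theory.
Import numFieldNormedType.Exports.
Local Open Scope classical_set_scope.
Local Open Scope ring_scope.

Set Implicit Arguments.
Unset Strict Implicit.
Unset Printing Implicit Defensive.

(** * Inner products and the Riesz theorem *)

(** The objects [adjoint], [bochner_integral], and hence [cov_int] and [drift_int], are choices made
    by [get]: nothing is known about them until existence is proved. This is why so much analysis
    precedes the Gaussian computation. Once existence is known, each of these vectors enters only
    through its pairings [ip _ h], which any admissible choice satisfies, so uniqueness never has to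
    be discussed and weak continuity in time is enough for the limits in the recursions. Likewise
    [gaussian_measure] only gives the law of one functional at a time. The Fourier representation
    fits this exactly: for each frequency theta it asks for the law of the single functional with
    vector M' theta, so the joint law of the coordinates of M u is never formed. Positive
    definiteness of P makes the weight integrable in theta uniformly in u, which is what justifies
    exchanging the integrals. Cosines with a free phase replace complex exponentials throughout. [H]
    may be non-separable, so sums of Borel maps into [H] need not be measurable; measurability is
    always obtained by special arguments. *)

Section inner_product.
Context {R : realType} {H : completeNormedModType R}.
Variable ip : {dot H for idfun}.
Hypothesis hip : induces_norm ip.
Implicit Types x y z : H.

Lemma ipC x y : ip x y = ip y x.
Proof. by rewrite (hermC ip) expr0 mul1r. Qed.

Lemma ipDl x y z : ip (x + y) z = ip x z + ip y z.
Proof. exact: linearDl. Qed.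

Lemma ipDr x y z : ip z (x + y) = ip z x + ip z y.
Proof. exact: linearDr. Qed.

Lemma ipBl x y z : ip (x - y) z = ip x z - ip y z.
Proof. exact: linearBl. Qed.

Lemma ipBr x y z : ip z (x - y) = ip z x - ip z y.
Proof. exact: linearBr. Qed.

Lemma ipZl (k : R) x y : ip (k *: x) y = k * ip x y.
Proof. exact: linearZl. Qed.

Lemma ipZr (k : R) x y : ip x (k *: y) = k * ip x y.
Proof. exact: linearZr. Qed.

Lemma ip0l x : ip 0 x = 0.
Proof. exact: linear0l. Qed.

Lemma ip0r x : ip x 0 = 0.
Proof. exact: linear0r. Qed.

Lemma ip_inj x y : (forall z, ip z x = ip z y) -> x = y.
Proof.
move=> xy; apply/eqP; rewrite -subr_eq0 -normr_eq0 -sqrf_eq0 -hip.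
by rewrite ipBr xy subrr.
Qed.

Lemma ler_ip x y : ip x y <= `|x| * `|y|.
Proof.
have [->|y0] := eqVneq y 0; first by rewrite ip0r normr0 mulr0.
have ny : 0 < `|y| by rewrite normr_gt0.
have [->|x0] := eqVneq x 0; first by rewrite ip0l normr0 mul0r.
have nx : 0 < `|x| by rewrite normr_gt0.
(* The square of this vector expands to 2 |x| |y| (|x| |y| - <x, y>). *)
have : 0 <= ip (`|y| *: x - `|x| *: y) (`|y| *: x - `|x| *: y).
  by rewrite hip sqr_ge0.
rewrite ipBl !ipBr !ipZl !ipZr !hip (ipC y x) => h.
have {h} : 0 <= 2 * (`|x| * `|y|) * (`|x| * `|y| - ip x y).
  by apply: le_trans h _; lra.
by rewrite pmulr_rge0 ?subr_ge0// mulr_gt0// mulr_gt0.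
Qed.

Lemma ler_norm_ip x y : `|ip x y| <= `|x| * `|y|.
Proof.
rewrite ler_norml ler_ip andbT lerNl.
by have := ler_ip (- x) y; rewrite -scaleN1r ipZl mulN1r scaleN1r normrN.
Qed.

(** Testing at [z := x] is enough. This turns estimates of pairings, the only ones available for
    adjoints, into norm estimates. *)
Lemma ip_norm_le x (C : R) : 0 <= C -> (forall z, `|ip z x| <= C * `|z|) ->
  `|x| <= C.
Proof.
move=> C0 /(_ x); have [->|x0] := eqVneq x 0; first by rewrite normr0.
by rewrite hip ger0_norm ?sqr_ge0// expr2 ler_pM2r// normr_gt0.
Qed.

Lemma ip_continuousl y : continuous (fun x => ip x y : R).
Proof.
move=> x; apply/cvgrPdist_lt => e e0; near=> z.
rewrite -ipBl; apply: le_lt_trans (ler_norm_ip _ _) _.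
have y1 : 0 < `|y| + 1 by rewrite ltr_wpDl.
apply: (@le_lt_trans _ _ (`|x - z| * (`|y| + 1))).
  by rewrite ler_wpM2l// lerDl.
rewrite -ltr_pdivlMr//; near: z.
by apply: (@cvgr_dist_lt _ _ _ (nbhs x) _ id x) => //; rewrite divr_gt0//.
Unshelve. all: by end_near. Qed.

Lemma cvg_ipl (T : Type) (F : set_system T) {FF : Filter F} (f : T -> H) y z :
  f @ F --> y -> ip (f t) z @[t --> F] --> (ip y z : R).
Proof. move=> fy; exact: cvg_comp fy (@ip_continuousl z y). Qed.

Lemma parallelogram x y :
  `|x - y| ^+ 2 = 2 * `|x| ^+ 2 + 2 * `|y| ^+ 2 - `|x + y| ^+ 2.
Proof. rewrite -!hip !(ipBl, ipDl) !(ipBr, ipDr) (ipC y x); lra. Qed.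

(** A predicate on bare functions, so that it applies directly to functionals given by integrals or
    by entries of an operator that carries no linear structure. *)
Definition bounded_functional (l : H -> R) :=
  (forall (k : R) x y, l (k *: x + y) = k * l x + l y) /\
  exists C, forall x, `|l x| <= C * `|x|.

(* The energy [|x|^2 / 2 - l x] attains its minimum over a closed subspace: by
   the parallelogram identity minimising sequences are Cauchy. Taking all of
   [H] yields the Riesz theorem, taking [l := ip ^~ h] the projection of [h]. *)
Lemma subspace_representer (W : set H) (l : H -> R) :
  closed W -> W 0 -> (forall (k : R) x y, W x -> W y -> W (k *: x + y)) ->
  bounded_functional l ->
  exists2 z, W z & forall x, W x -> l x = ip x z.
Proof.
move=> Wc W0 Wl [ll [C lC]].
pose J x : R := 2^-1 * `|x| ^+ 2 - l x.
have J_lb : lbound [set J x | x in W] (- (2^-1 * C ^+ 2)).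
  move=> _ [x _ <-]; rewrite /J.
  have lx : l x <= C * `|x| by apply: le_trans (lC x); rewrite ler_norm.
  have := sqr_ge0 (`|x| - C); nra.
have JW : has_inf [set J x | x in W].
  by split; [exists (J 0), 0|exists (- (2^-1 * C ^+ 2))].
pose j := inf [set J x | x in W].
have J_ge x : W x -> j <= J x.
  by move=> Wx; apply: (ge_inf JW.2); exists x.
(* Twice [J] at the midpoint is J x + J y - |x - y|^2 / 4, and [J] is at least [j] at the midpoint,
   which lies in [W]. *)
have J_par x y : W x -> W y -> `|x - y| ^+ 2 <= 4 * (J x - j) + 4 * (J y - j).
  move=> Wx Wy.
  have Wm : W (2^-1 *: (x + y)).
    by rewrite scalerDr -[2^-1 *: y]addr0; apply: (Wl) => //; apply: Wl.
  have := J_ge _ Wm; rewrite parallelogram /J.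
  have -> : l (2^-1 *: (x + y)) = 2^-1 * (l x + l y).
    have l0 : l 0 = 0.
      by have := ll 1 0 0; rewrite scale1r addr0 mul1r => /eqP; rewrite addrC -subr_eq subrr => /eqP.
    by rewrite -[2^-1 *: _]addr0 ll l0 addr0 -[x in x + y]scale1r ll mul1r.
  rewrite normrZ exprMn ger0_norm ?invr_ge0//; lra.
have /choice[u uP] : forall n : nat, exists x, W x /\ J x < j + n.+1%:R^-1.
  move=> n; have [_ [x Wx <-] Jx] := inf_adherent (ltac:(by rewrite invr_gt0) : 0 < n.+1%:R^-1) JW.
  by exists x.
have u_cauchy : cauchy (u @ \oo).
  apply/cauchyP => e e0.
  (* With both excesses over [j] below e^2 / 8, the bound [J_par] gives less than 4 (e^2 / 8) + 4
     (e^2 / 8) = e^2. *)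
  have [N _ HN] : \forall n \near \oo, n.+1%:R^-1 < e ^+ 2 / 8 :> R.
    apply: (near_infty_natSinv_lt (PosNum _)); rewrite divr_gt0// exprn_gt0//.
  exists (u N).
  suff: \forall n \near \oo, ball (u N) e (u n) by [].
  near=> n.
  rewrite -ball_normE /ball_/=.
  rewrite -(ltr_pXn2r (n := 2))// ?nnegrE// ?ltW//.
  have [WN JN] := uP N; have [Wn Jn] := uP n.
  apply: le_lt_trans (J_par _ _ WN Wn) _.
  have nN : (N <= n)%N by near: n; exact: nbhs_infty_ge.
  have /= := HN N (leqnn _); have /= := HN n nN.
  move: JN Jn; move: (N.+1%:R^-1) (n.+1%:R^-1) => ? ?; lra.
have u_cvg : cvg (u @ \oo) by apply/cauchy_cvgP.
pose z := lim (u @ \oo).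
have Wz : W z.
  apply: (@closed_cvg _ _ \oo _ u W Wc _ z u_cvg).
  by near=> n; have [] := uP n.
have lcont : {for z, continuous l}.
  apply/cvgrPdist_lt => e e0; near=> x.
  have -> : l z - l x = l (- 1 *: x + z) by rewrite ll; lra.
  apply: le_lt_trans (lC _) _.
  have C1 : 0 < `|C| + 1 by rewrite ltr_wpDl.
  apply: (@le_lt_trans _ _ ((`|C| + 1) * `|z - x|)).
    rewrite scaleN1r addrC ler_wpM2r//; have := ler_norm C; lra.
  rewrite mulrC -ltr_pdivlMr//; near: x.
  by apply: (@cvgr_dist_lt _ _ _ (nbhs z) _ id z) => //; rewrite divr_gt0//.
have Jz : J z <= j.
  have Ju : (J \o u) n @[n --> \oo] --> J z.
    apply: cvgB; last exact: (cvg_comp _ _ u_cvg lcont).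
    apply: cvgM; first exact: cvg_cst.
    have nu : `|u n| @[n --> \oo] --> `|z| by apply: cvg_norm.
    exact: (cvgM nu nu).
  have ju : j + n.+1%:R^-1 @[n --> \oo] --> j + 0.
    apply: cvgD; [exact: cvg_cst|exact: cvg_harmonic].
  rewrite addr0 in ju.
  rewrite -(cvg_lim _ Ju)// -(cvg_lim _ ju)//; apply: ler_lim.
  - by apply/cvg_ex; exists (J z).
  - by apply/cvg_ex; exists j.
  - by near=> n; have [_ /ltW] := uP n.
exists z => // x Wx; apply/eqP; apply: contraT => lxz.
have x0 : x != 0.
  apply: contra_neq lxz => ->; rewrite ip0l.
  by have := ll (- 1) 0 0; rewrite scaler0 addr0 => ?; lra.
have nx : 0 < `|x| ^+ 2 by rewrite exprn_gt0// normr_gt0.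
(* The step along [x] that minimises [J (z + k x)]; it lowers [J] by k (l x - <x, z>) / 2, which is
   positive, against minimality at [z]. *)
pose k := (l x - ip x z) / `|x| ^+ 2.
have := J_ge _ (Wl k x z Wx Wz).
rewrite /J ll -hip ipDl !ipDr !ipZl !ipZr (ipC z x) !hip.
move: Jz; rewrite /J.
have kx : k * `|x| ^+ 2 = l x - ip x z by rewrite /k divfK// gt_eqF.
have k0 : 0 < k * (k * `|x| ^+ 2).
  by rewrite mulrA -expr2 mulr_gt0// exprn_even_gt0//= mulf_neq0 ?subr_eq0// invr_neq0// gt_eqF.
move: k0; rewrite kx => k0.
have : k * (k * `|x| ^+ 2) = k * (l x - ip x z) by rewrite kx.
lra.
Unshelve. all: by end_near. Qed.

Lemma riesz (l : H -> R) : bounded_functional l ->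
  exists z, forall x, l x = ip x z.
Proof.
by move=> /(subspace_representer closedT I) [//|z _ lz]; exists z => x; exact: lz.
Qed.

Lemma orthogonal_projection (W : set H) (h : H) :
  closed W -> W 0 -> (forall (k : R) x y, W x -> W y -> W (k *: x + y)) ->
  exists2 p, W p & forall x, W x -> ip x (h - p) = 0.
Proof.
move=> Wc W0 Wl.
have hb : bounded_functional (ip^~ h).
  split=> [k x y|]; first by rewrite ipDl ipZl.
  by exists `|h| => x; rewrite mulrC ler_norm_ip.
have [p Wp lp] := subspace_representer Wc W0 Wl hb.
by exists p => // x Wx; rewrite ipBr lp// subrr.
Qed.

(** The Riesz vector shows that the set from which [get] chooses is inhabited, so the chosen vector
    does represent the functional. *)
Lemma adjointP (V : pointedType) (ipV : V -> V -> R) (M : H -> V) (y : V) :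
  bounded_functional (fun x => ipV (M x) y) ->
  forall x, ipV (M x) y = ip x (adjoint ip ipV M y).
Proof.
move=> /riesz[z Mz]; rewrite /adjoint.
by have /getPex : [set z : H | forall x, ipV (M x) y = ip x z] !=set0 by exists z.
Qed.

End inner_product.

(** * Operator bounds, right limits and integrals over intervals *)

Lemma linear_bound (R : realType) (V W : normedModType R) (f : {linear V -> W}) :
  continuous f -> exists2 M, 0 < M & forall x, `|f x| <= M * `|x|.
Proof.
move=> /linear_bounded_continuous/linear_boundedP[M [_ fM]].
exists (`|M| + 1); first by rewrite ltr_wpDl.
by apply: fM; rewrite (le_lt_trans (ler_norm _))// ltrDl.
Qed.

Lemma at_right0_near (R : realType) (P : set R) :
  (\forall t \near 0^'+, P t) ->
  exists2 d, 0 < d & forall t, 0 < t -> t < d -> P t.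
Proof.
rewrite near_withinE => /nbhs_normP[d /= d0 dP]; exists d => // t t0 td.
by apply: dP => //=; rewrite sub0r normrN gtr0_norm.
Qed.

Section real_integrals.
Context {R : realType}.
Local Notation mu := (@lebesgue_measure R).

Lemma continuous_itv_integrable (f : R -> R) (a b : R) : continuous f ->
  mu.-integrable `[a, b] (EFin \o f).
Proof.
move=> cf; apply: continuous_compact_integrable; first exact: segment_compact.
by apply: continuous_subspaceT.
Qed.

Lemma fine_lebesgue_itv (a b : R) : a <= b -> fine (mu `[a, b]) = b - a.
Proof.
move=> ab; rewrite lebesgue_measure_itv/= lte_fin; case: ltP => // ba.
by rewrite (le_anti (introT andP (conj ab ba))) subrr.
Qed.

Lemma le_Rintegral_itv (f : R -> R) (a b K : R) : a <= b ->
  mu.-integrable `[a, b] (EFin \o f) -> (forall x, a <= x <= b -> `|f x| <= K) ->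
  `|\int[mu]_(x in `[a, b]) f x| <= K * (b - a).
Proof.
move=> ab fi fK; apply: le_trans (le_normr_Rintegral _ fi) _ => //.
have -> : K * (b - a) = \int[mu]_(x in `[a, b]) K.
  by rewrite Rintegral_cst//; congr (_ * _); exact/esym/fine_lebesgue_itv.
apply: le_Rintegral => //.
- exact: integrable_abse fi.
- apply: continuous_itv_integrable; exact: cst_continuous.
Qed.

Lemma Rintegral_shift (f : R -> R) (a b t : R) : a <= b -> continuous f ->
  \int[mu]_(x in `[a, b]) f (x + t) = \int[mu]_(x in `[a + t, b + t]) f x.
Proof.
move=> ab cf; rewrite /Rintegral; congr fine.
have D1 : (fun x : R => x + t)^`()%classic = cst 1.
  apply/funext => x; rewrite derive1E deriveD// derive_id derive_cst addr0//.
rewrite (integration_by_substitution_increasing (F := fun x => x + t))//.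
- by apply: eq_integral => x _; rewrite D1 /= mulr1.
- by move=> x y _ _ xy; rewrite ltrD2r.
- by rewrite D1 => x _; exact: cst_continuous.
- by rewrite D1; exact: is_cvg_cst.
- by rewrite D1; exact: is_cvg_cst.
- have ct : continuous (fun x : R => x + t).
    by move=> x; apply: cvgD; [exact: cvg_id|exact: cvg_cst].
  split.
  + by move=> x _; apply: derivableD.
  + exact/cvg_at_right_filter/ct.
  + exact/cvg_at_left_filter/ct.
- exact: continuous_subspaceT.
Qed.

Lemma Rintegral_itv_cat (f : R -> R) (a b c : R) : a <= b -> b <= c ->
  mu.-integrable `[a, c] (EFin \o f) ->
  \int[mu]_(x in `[a, c]) f x =
  \int[mu]_(x in `[a, b]) f x + \int[mu]_(x in `[b, c]) f x.
Proof.
move=> ab bc fi.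
have := Rintegral_itvB fi (x := b).
rewrite !bnd_simp => /(_ ab bc).
rewrite Rintegral_itv_obnd_cbnd; first by move=> <-; rewrite addrC subrK.
apply: integrableS fi => //= x /=; rewrite !in_itv/= => /andP[bx ->].
by rewrite andbT (le_trans ab)// ltW.
Qed.

(** Both windows lie in [0, r + t]. Cutting that interval at [t] and at [r] shows that the
    difference is the integral over [r, r + t] minus the one over [0, t], each at most K t. *)
Lemma le_Rintegral_shiftB (f : R -> R) (r t K : R) : 0 <= r -> 0 <= t ->
  continuous f -> (forall x, 0 <= x <= r + t -> `|f x| <= K) ->
  `|\int[mu]_(x in `[0, r]) f (x + t) - \int[mu]_(x in `[0, r]) f x|
    <= 2 * K * t.
Proof.
move=> r0 t0 cf fK; rewrite Rintegral_shift// add0r.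
have fi := continuous_itv_integrable 0 (r + t) cf.
have tr : t <= r + t by rewrite lerDr.
have rt : r <= r + t by rewrite lerDl.
have := Rintegral_itv_cat r0 rt fi.
rewrite (Rintegral_itv_cat t0 tr fi) => h.
have b1 : `|\int[mu]_(x in `[0, t]) f x| <= K * (t - 0).
  apply: le_Rintegral_itv => //; first exact: continuous_itv_integrable.
  by move=> x xt; apply: fK; lra.
have b2 : `|\int[mu]_(x in `[r, r + t]) f x| <= K * (r + t - r).
  apply: le_Rintegral_itv; first lra; first exact: continuous_itv_integrable.
  by move=> x xt; apply: fK; lra.
move: b1 b2 h; rewrite !ler_norml; lra.
Qed.

(** Averages of [f] over short intervals [0, r] are close to [f 0]; here they all vanish. *)
Lemma continuous_Rintegral_eq0 (f : R -> R) : continuous f ->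
  (forall r, 0 < r -> \int[mu]_(x in `[0, r]) f x = 0) -> f 0 = 0.
Proof.
move=> cf f0; apply/eqP; rewrite -normr_eq0 eq_le normr_ge0 andbT.
apply/ler_addgt0Pl => e e0; rewrite addr0.
have /cvgrPdist_le/(_ e e0) := cf 0.
move=> /nbhs_normP[d /= d0 dP].
have d2 : 0 < d / 2 by rewrite divr_gt0.
have : `|\int[mu]_(x in `[0, d / 2]) (f 0 - f x)| <= e * (d / 2 - 0).
  apply: le_Rintegral_itv; first exact: ltW.
    by apply: continuous_itv_integrable => x; apply: cvgB (cf x); exact: cvg_cst.
  by move=> x xd; apply: dP => /=; rewrite sub0r normrN ger0_norm; lra.
rewrite RintegralB//; last 2 first.
- by apply: continuous_itv_integrable; exact: cst_continuous.
- exact: continuous_itv_integrable.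
rewrite f0// subr0 Rintegral_cst//.
rewrite [X in `|_ * X|](_ : _ = d / 2); last first.
  by rewrite -[RHS]subr0 -fine_lebesgue_itv ?ltW.
by rewrite subr0 normrM (gtr0_norm d2) ler_pM2r.
Qed.

End real_integrals.

(** * The semigroup and its adjoint *)

Section strong_continuity.
Context {R : realType} {H : completeNormedModType R}.

(** Stated for bare maps in order to serve both the semigroup and its adjoint. The truncation
    [Num.max 0 t] extends the orbit by its value at 0 to negative times, where the semigroup carries
    no meaning, so that continuity holds on the whole line. *)
Lemma semigroup_continuous (T : R -> H -> H) :
  (forall t x y, 0 <= t -> T t (x - y) = T t x - T t y) ->
  (forall b, exists2 M, 0 < M & forall t x, 0 <= t <= b -> `|T t x| <= M * `|x|) ->
  (forall x, T 0 x = x) ->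
  (forall s t x, 0 <= s -> 0 <= t -> T (s + t) x = T s (T t x)) ->
  (forall x, T h x @[h --> (0 : R)^'+] --> x) ->
  forall x, continuous (fun t : R => T (Num.max 0 t) x).
Proof.
move=> TB Tb T0 TD Tc x t0; apply/cvgrPdist_lt => e e0.
have [M M0 TM] := Tb (`|t0| + 1).
have /cvgrPdist_lt/(_ (e / M)) := Tc x.
rewrite divr_gt0// => /(_ isT)/at_right0_near[d d0 dP].
(* Factoring out the smaller time, T hi x - T lo x = T lo (T (hi - lo) x - x), treats left and right
   continuity at once. *)
have key lo hi : 0 <= lo -> lo <= hi -> hi <= `|t0| + 1 -> hi - lo < d ->
    `|T hi x - T lo x| < e.
  move=> lo0 lohi hib hld.
  have [->|hl] := eqVneq hi lo; first by rewrite subrr normr0.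
  have -> : T hi x = T lo (T (hi - lo) x) by rewrite -TD ?subr_ge0// addrC subrK.
  rewrite -TB//; apply: le_lt_trans (TM _ _ _) _.
    by rewrite lo0 (le_trans lohi).
  have hl0 : 0 < hi - lo by rewrite subr_gt0 lt_neqAle eq_sym hl.
  rewrite mulrC -ltr_pdivlMr// distrC; exact: dP.
near=> t.
have tt : `|t0 - t| < d by near: t; exact: (@cvgr_dist_lt _ _ _ (nbhs t0) _ id t0).
have t1 : `|t0 - t| < 1 by near: t; exact: (@cvgr_dist_lt _ _ _ (nbhs t0) _ id t0).
have [le|/ltW le] := leP (Num.max 0 t) (Num.max 0 t0).
  apply: key => //.
  - by rewrite le_max lexx.
  - by have := ler_norm t0; rewrite maxEle; case: ifP => //; lra.
  - move: tt; rewrite !maxEle ltr_norml; do 2 case: ifPn; rewrite -?ltNge; lra.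
rewrite distrC; apply: key => //.
- by rewrite le_max lexx.
- have := ler_norm t0; have := normr_ge0 t0.
  by move: t1; rewrite ltr_norml maxEle; case: ifP; lra.
- move: tt; rewrite !maxEle ltr_norml; do 2 case: ifPn; rewrite -?ltNge; lra.
Unshelve. all: by end_near. Qed.

End strong_continuity.

Section semigroup.
Context {R : realType} {H : completeNormedModType R}.
Variable S : R -> {linear H -> H}.
Hypothesis hS : C0_semigroup S.

(** Otherwise there are times t_n <= 1/(n+1) and vectors of norm at most 1 whose images have norm
    above n. Strong continuity at 0 bounds S t_n pointwise, so this contradicts Banach-Steinhaus. *)
Let S_near0_bounded : exists d : R, exists2 K, 0 < d &
  forall t x, 0 <= t <= d -> `|x| <= 1 -> `|S t x| <= K.
Proof.
have [S_cont S0 SD Sc] := hS.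
apply: contrapT => noK.
have /choice[tx txP] : forall n : nat, exists p : R * H,
    [/\ 0 <= p.1 <= n.+1%:R^-1, `|p.2| <= 1 & n%:R < `|S p.1 p.2|].
  move=> n; apply: contrapT => nop; apply: noK.
  exists n.+1%:R^-1, n%:R => // t x tn x1.
  by rewrite leNgt; apply/negP => Sn; apply: nop; exists (t, x).
pose F : set (H -> H) := [set (S (tx n).1 : H -> H) | n in setT].
have Fb : uniform_bounded F.
  apply: Banach_Steinhauss.
    move=> _ [n _ <-]; split; last exact: linearP.
    have [/andP[t0 _] _ _] := txP n.
    have [M M0 SM] := linear_bound (S_cont _ t0).
    move=> r; exists (M * r) => x xr; apply: le_trans (SM x) _.
    by rewrite ler_pM2l.
  move=> x.
  have /cvgrPdist_lt/(_ 1 ltr01)/at_right0_near[d d0 dP] := Sc x.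
  have [N _ HN] := near_infty_natSinv_lt (PosNum d0).
  (* From index [N] on, S t_n x is within 1 of [x]; the sum covers the finitely many earlier
     operators. *)
  exists (`|x| + 1 + \sum_(k < N) `|S (tx k).1 x|) => _ [n _ <-].
  have s0 : 0 <= \sum_(k < N) `|S (tx k).1 x| by apply: sumr_ge0.
  have [Nn|nN] := leqP N n; last first.
    rewrite (bigD1 (Ordinal nN))//= addrCA lerDl addr_ge0//.
    by apply: sumr_ge0.
  have [/andP[t0 tn] _ _] := txP n.
  rewrite -[leLHS]addr0 lerD//.
  have [->|tn0] := eqVneq (tx n).1 0; first by rewrite S0 lerDl.
  have tp : 0 < (tx n).1 by rewrite lt_neqAle eq_sym tn0.
  have : `|x - S (tx n).1 x| < 1.
    apply: dP => //.
    exact: le_lt_trans tn (HN n Nn).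
  have := ler_normB x (x - S (tx n).1 x); rewrite opprB addrCA subrr addr0; lra.
have [M MP] := Fb 1.
pose n := (Num.truncn `|M|).+1.
have [_ x1 nS] := txP n.
have := MP _ (ex_intro2 _ _ n I erefl) _ x1; apply/negP; rewrite -ltNge.
apply: le_lt_trans nS; apply: le_trans (ler_norm _) _.
by apply/ltW; rewrite -truncn_le_nat// leqnn.
Qed.

(** A time up to [b] splits into at most [n] steps of length at most [d], each costing a factor [M].
    Taking M >= 1, whatever the sign of [K], makes M ^+ n a bound for shorter times too. *)
Lemma semigroup_bounded b :
  exists2 M, 0 < M & forall t x, 0 <= t <= b -> `|S t x| <= M * `|x|.
Proof.
have [S_cont S0 SD Sc] := hS.
have [d [K d0 SK]] := S_near0_bounded.
pose M := `|K| + 1.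
have M1 : 1 <= M by rewrite lerDr.
have M0 : 0 < M by rewrite (lt_le_trans ltr01).
have SM t x : 0 <= t <= d -> `|S t x| <= M * `|x|.
  move=> td; have [->|x0] := eqVneq x 0; first by rewrite linear0 normr0 mulr0.
  have nx : 0 < `|x| by rewrite normr_gt0.
  rewrite -ler_pdivrMr// mulrC -(gtr0_norm (_ : 0 < `|x|^-1)) ?invr_gt0//.
  rewrite -normrZ -linearZ; apply: (@le_trans _ _ K).
    by apply: SK => //; rewrite normrZ gtr0_norm ?invr_gt0// mulVf// gt_eqF.
  by rewrite (le_trans (ler_norm K))// lerDl.
have Sn n t x : 0 <= t <= n%:R * d -> `|S t x| <= M ^+ n * `|x|.
  elim: n t x => [|n IH] t x.
    rewrite mul0r => /andP[t0 t1]; have -> : t = 0 by lra.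
    by rewrite S0 expr0 mul1r.
  move=> /andP[t0 tn]; have [td|dt] := leP t d.
    apply: le_trans (SM _ _ _) _; first by rewrite t0.
    by rewrite ler_wpM2r// exprS ler_pMr// exprn_ege1.
  have -> : t = d + (t - d) by lra.
  rewrite SD ?subr_ge0 ?(ltW dt) ?(ltW d0)//.
  apply: le_trans (SM _ _ _) _; first by rewrite lexx (ltW d0).
  rewrite exprS -mulrA ler_pM2l//; apply: IH.
  by rewrite subr_ge0 (ltW dt)/=; move: tn; rewrite -addn1 natrD mulrDl mul1r; lra.
pose n := (Num.truncn `|b / d|).+1.
exists (M ^+ n); first by rewrite exprn_gt0.
move=> t x /andP[t0 tb]; apply: Sn; rewrite t0 (le_trans tb)//.
rewrite -ler_pdivrMr// (le_trans (ler_norm _))//.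
by apply/ltW; rewrite -truncn_le_nat// leqnn.
Qed.

Lemma S_continuous x : continuous (fun t : R => S (Num.max 0 t) x).
Proof.
have [S_cont S0 SD Sc] := hS.
apply: (@semigroup_continuous _ _ (fun t => S t : H -> H)) => //; last exact: semigroup_bounded.
by move=> t y z _; rewrite linearB.
Qed.

Variable ip : {dot H for idfun}.
Hypothesis hip : induces_norm ip.
Local Notation Sa t := (adjoint ip ip (S t)).

Lemma SaP t x y : 0 <= t -> ip (S t x) y = ip x (Sa t y).
Proof.
have [S_cont _ _ _] := hS => t0; move: x; apply: (adjointP hip); split.
  by move=> k x z; rewrite linearP/= ipDl ipZl.
have [M M0 SM] := linear_bound (S_cont _ t0).
exists (M * `|y|) => x; apply: le_trans (ler_norm_ip hip _ _) _.
by rewrite mulrAC ler_wpM2r.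
Qed.

Lemma Sa_linear t : 0 <= t -> linear (Sa t).
Proof.
move=> t0 k x y; apply: (ip_inj hip) => z.
by rewrite ipDr ipZr -!SaP// ipDr ipZr.
Qed.

Lemma SaB t x y : 0 <= t -> Sa t (x - y) = Sa t x - Sa t y.
Proof. by move=> t0; apply: (ip_inj hip) => z; rewrite ipBr -!SaP// ipBr. Qed.

Lemma Sa_semigroup s t x : 0 <= s -> 0 <= t -> Sa (s + t) x = Sa s (Sa t x).
Proof.
have [_ _ SD _] := hS => s0 t0; apply: (ip_inj hip) => z.
by rewrite -!SaP// ?addr_ge0// addrC SD.
Qed.

Lemma Sa_bounded b :
  exists2 M, 0 < M & forall t x, 0 <= t <= b -> `|Sa t x| <= M * `|x|.
Proof.
have [M M0 SM] := semigroup_bounded b; exists M => // t x tb.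
apply: (ip_norm_le hip); first by rewrite mulr_ge0// ltW.
move=> z; rewrite -SaP; last by case/andP: tb.
apply: le_trans (ler_norm_ip hip _ _) _.
by rewrite mulrAC ler_wpM2r// SM.
Qed.

Let W : set H := [set h | Sa t h @[t --> 0^'+] --> h].

(** Local uniform boundedness of the adjoint lets strong continuity pass to the limit: replacing [h]
    by a nearby [h'] costs at most (M + 1) |h - h'|. *)
Let closed_W : closed W.
Proof.
have [M M0 SM] := Sa_bounded 1.
move=> h hW; apply/cvgrPdist_lt => e e0.
have M1 : 0 < M + 1 by rewrite addr_gt0.
have e2 : 0 < e / 2 / (M + 1) by rewrite !divr_gt0.
have [h' [Wh']] := hW _ (nbhsx_ballx h _ e2).
rewrite -ball_normE /ball_/= => hh'.
near=> t.
have t01 : 0 <= t <= 1.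
  by apply/andP; split; near: t; [exact: nbhs_right_ge|exact: nbhs_right_le].
have t0 : 0 <= t by case/andP: t01.
have h1 : `|h' - Sa t h'| < e / 2.
  near: t; apply: cvgr_dist_lt => //; exact: divr_gt0.
have h2 : `|Sa t (h' - h)| <= M * `|h - h'| by rewrite distrC SM.
have -> : h - Sa t h = (h - h') + (h' - Sa t h') + Sa t (h' - h).
  by rewrite SaB// -addrA !subrKA.
have h3 : (M + 1) * `|h - h'| < e / 2 by rewrite mulrC -ltr_pdivlMr.
apply: le_lt_trans (ler_normD _ _) _.
have := ler_normD (h - h') (h' - Sa t h').
move: h1 h2 h3; rewrite mulrDl mul1r; lra.
Unshelve. all: by end_near. Qed.

(** The vector [z] is the weak integral of the adjoint orbit of [h] over [0, r]. It comes from
    Riesz, since strong continuity of that orbit is still to be proved. Applying the adjoint at time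
    t shifts the window by t, and by [le_Rintegral_shiftB] this moves [z] by O(t) in norm, because
    the bound is uniform over the test vectors. *)
Let average_W (h : H) (r : R) : 0 < r -> exists2 z, W z &
  forall x, ip x z = \int[@lebesgue_measure R]_(u in `[0, r])
    (ip (S (Num.max 0 u) x) h : R).
Proof.
move=> r0.
(* The margin 1 accommodates the window shifted by t <= 1. *)
have [M M0 SM] := semigroup_bounded (r + 1).
pose phi x u : R := ip (S (Num.max 0 u) x) h.
have phic x : continuous (phi x).
  move=> u; apply: (@cvg_ipl _ _ ip hip _ (nbhs u)); exact: S_continuous.
have phii x : (@lebesgue_measure R).-integrable `[0, r] (EFin \o phi x).
  exact: continuous_itv_integrable.
have phib x u : 0 <= u <= r + 1 -> `|phi x u| <= M * `|x| * `|h|.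
  move=> ur; apply: le_trans (ler_norm_ip hip _ _) _; rewrite ler_wpM2r// SM//.
  by rewrite maxEle; case: ifP => //; lra.
have [z zP] : exists z, forall x, ip x z =
    \int[@lebesgue_measure R]_(u in `[0, r]) (phi x u).
  suff : bounded_functional (fun x => \int[@lebesgue_measure R]_(u in `[0, r]) (phi x u)).
    by move=> /(riesz hip)[z zP]; exists z.
  split.
    move=> k x y; rewrite -RintegralZl// -RintegralD//; last first.
      rewrite [X in _.-integrable _ X](_ : _ = (fun u => k%:E * (EFin \o phi x) u)%E)//.
      exact: integrableZl.
    by apply: eq_Rintegral => u _; rewrite /phi linearP/= ipDl ipZl.
  exists (M * `|h| * r) => x.
  have := @le_Rintegral_itv R (phi x) 0 r (M * `|x| * `|h|) (ltW r0) (phii x).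
  rewrite subr0 => /(_ _)/le_trans; apply; last by rewrite le_eqVlt; apply/orP; left; apply/eqP; ring.
  by move=> u ur; apply: phib; lra.
exists z => //; rewrite /W/=; apply/cvgrPdist_lt => e e0.
pose K := 2 * (M * `|h|).
have K0 : 0 <= K by rewrite !mulr_ge0// ltW.
have K1 : 0 < K + 1 by rewrite ltr_wpDl.
near=> t.
have t0 : 0 <= t by near: t; exact: nbhs_right_ge.
have t1 : t <= 1 by near: t; exact: nbhs_right_le.
rewrite distrC; apply: (@le_lt_trans _ _ (K * t)); last first.
  apply: (@le_lt_trans _ _ ((K + 1) * t)); first by rewrite ler_wpM2r// lerDl.
  rewrite -ltr_pdivlMl//; near: t; apply: nbhs_right_lt; by rewrite mulr_gt0// invr_gt0.
apply: (ip_norm_le hip); first exact: mulr_ge0.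
move=> x; rewrite ipBr -SaP// !zP.
have -> : \int[@lebesgue_measure R]_(u in `[0, r]) (phi (S t x) u) =
    \int[@lebesgue_measure R]_(u in `[0, r]) (phi x (u + t)).
  apply: eq_Rintegral => u; rewrite inE/= in_itv/= => /andP[u0 ur]; rewrite /phi.
  have [_ _ SD _] := hS.
  by rewrite !max_r ?addr_ge0// SD.
apply: le_trans (le_Rintegral_shiftB (ltW r0) t0 (phic x) (K := M * `|x| * `|h|) _) _.
  by move=> u ur; apply: phib; lra.
by rewrite /K le_eqVlt; apply/orP; left; apply/eqP; ring.
Unshelve. all: by end_near. Qed.

(* The averages of the orbit of [h] lie in the closed subspace [W] of strong
   continuity and converge weakly to [h], so [h - p], with [p] the projection of
   [h] on [W], is orthogonal to [h] and to [p]. *)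
Lemma Sa_strongly_continuous h : Sa t h @[t --> 0^'+] --> h.
Proof.
have Wl (k : R) x y : W x -> W y -> W (k *: x + y).
  rewrite /W/= => Wx Wy.
  have : k *: Sa t x + Sa t y @[t --> 0^'+] --> k *: x + y.
    by apply: cvgD => //; apply: cvgZr.
  apply: cvg_trans; apply: near_eq_cvg; near=> t.
  by rewrite Sa_linear.
have W0 : W 0.
  rewrite /W/=; have : (0 : H) @[t --> (0 : R)^'+] --> (0 : H) by exact: cvg_cst.
  apply: cvg_trans; apply: near_eq_cvg; near=> t.
  have t0 : 0 <= t by near: t; exact: nbhs_right_ge.
  by apply/esym/(ip_inj hip) => z; rewrite -SaP// !ip0r.
have [p Wp pP] := orthogonal_projection hip h closed_W W0 Wl.
pose v := h - p.
pose phi u : R := ip (S (Num.max 0 u) v) h.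
have phic : continuous phi.
  move=> u; apply: (@cvg_ipl _ _ ip hip _ (nbhs u)); exact: S_continuous.
have : phi 0 = 0.
  apply: continuous_Rintegral_eq0 => // r r0.
  have [z Wz zP] := average_W h r0.
  by rewrite -zP ipC; exact: pP.
rewrite /phi max_l//; have [_ -> _ _] := hS => vh.
have : ip v v = 0 by rewrite {2}/v ipBr vh (ipC ip v) pP// subrr.
rewrite hip => /eqP; rewrite sqrf_eq0 normr_eq0 subr_eq0 => /eqP ->.
exact: Wp.
Unshelve. all: by end_near. Qed.

Lemma Sa_continuous h : continuous (fun t : R => Sa (Num.max 0 t) h).
Proof.
have [_ S0 _ _] := hS; apply: (@semigroup_continuous _ _ (fun t => Sa t)).
- by move=> t x y; exact: SaB.
- exact: Sa_bounded.
- by move=> x; apply: (ip_inj hip) => z; rewrite -SaP// S0.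
- exact: Sa_semigroup.
- exact: Sa_strongly_continuous.
Qed.

End semigroup.

(** * The Bochner integral *)

Section borel_measurability.
Context {R : realType} {H : completeNormedModType R}.

Lemma open_borel (U : set H) : open U -> measurable (U : set (borel H)).
Proof. by move=> oU; exact: sub_sigma_algebra. Qed.

Lemma measurable_fun_borel d (T : measurableType d) (D : set T) (f : T -> borel H) :
  measurable D ->
  (forall U : set H, open U -> measurable (D `&` f @^-1` U)) ->
  measurable_fun D f.
Proof.
move=> mD h; apply: (@measurability _ _ T (borel H) D f (@open H) erefl).
by move=> _ [U oU <-]; exact: h.
Qed.

Lemma continuous_borel_measurable (g : H -> R) : continuous g ->
  measurable_fun setT (g : borel H -> R).
Proof.
move=> /continuousP cg; apply: (measurability _ (RGenOpens.measurableE R)) => //.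
move=> _ [_ [a [b ->]] <-]; rewrite setTI; apply: open_borel.
exact/cg/interval_open.
Qed.

Lemma measurable_fun_comp_continuous d (T : measurableType d) (D : set T)
    (f : T -> borel H) (g : H -> R) : continuous g -> measurable_fun D f ->
  measurable_fun D (fun x => g (f x)).
Proof. by move=> /continuous_borel_measurable mg; exact: measurableT_comp. Qed.

Lemma measurable_fun_norm_borel d (T : measurableType d) (D : set T)
    (f : T -> borel H) : measurable_fun D f ->
  measurable_fun D (fun x => `|f x : H|).
Proof.
move=> mf; apply: (@measurable_fun_comp_continuous _ _ D f (fun x => `|x|)) => //.
exact: norm_continuous.
Qed.

Lemma measurable_fun_sub_indic d (T : measurableType d) (D A : set T)
    (f : T -> H) (v : H) : measurable D -> measurable A ->
  measurable_fun D (f : T -> borel H) ->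
  measurable_fun D ((fun x => f x - (\1_A x : R) *: v) : T -> borel H).
Proof.
move=> mD mA mf; apply: measurable_fun_borel => // U oU.
have -> : D `&` (fun x => f x - (\1_A x : R) *: v) @^-1` U =
    (A `&` (D `&` f @^-1` [set y | U (y - v)])) `|` ((D `&` f @^-1` U) `\` A).
  apply/seteqP; split=> x /=.
    move=> [Dx]; rewrite indicE; have [Ax|Ax] := boolP (x \in A).
      by rewrite scale1r => Ux; left; split=> //; exact: set_mem.
    rewrite scale0r subr0 => Ux; right; split=> // Ax'.
    by move/negP: Ax; apply; rewrite inE.
  move=> [[Ax [Dx Ux]]|[[Dx Ux] Ax]]; split=> //; rewrite indicE.
    by rewrite mem_set//= scale1r.
  by rewrite memNset//= scale0r subr0.
apply: measurableU.
  apply: measurableI => //; apply: mf => //; apply: open_borel.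
  apply: (@open_comp _ _ (fun y => y - v) U) => // y _.
  by apply: cvgB; [exact: cvg_id|exact: cvg_cst].
by apply: measurableD => //; apply: mf => //; exact: open_borel.
Qed.

End borel_measurability.

Section bochner.
Context {R : realType} {H : completeNormedModType R}.
Context (d : measure_display) (T : measurableType d).
Variables (mu : {measure set T -> \bar R}) (D : set T).
Hypothesis mD : measurable D.
Local Notation I := (simple_integral mu D).
Local Notation sf := (@simple_fun R H T).
Implicit Types (s : seq (set T * H)) (f : T -> H).

Definition integrable_steps s :=
  forall p, p \in s -> measurable p.1 /\ (mu (D `&` p.1) < +oo)%E.

Lemma integrable_steps_cons p s : integrable_steps (p :: s) <->
  (measurable p.1 /\ (mu (D `&` p.1) < +oo)%E) /\ integrable_steps s.
Proof.
split=> [h|[hp hs] q].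
  by split=> [|q qs]; apply: h; rewrite in_cons ?eqxx// qs orbT.
by rewrite in_cons => /predU1P[->//|]; exact: hs.
Qed.

Lemma integrable_steps_cat s1 s2 :
  integrable_steps s1 -> integrable_steps s2 -> integrable_steps (s1 ++ s2).
Proof. by move=> h1 h2 p; rewrite mem_cat => /orP[/h1|/h2]. Qed.

Definition opp_steps s := [seq (p.1, - p.2) | p <- s].

Lemma integrable_steps_opp s : integrable_steps s -> integrable_steps (opp_steps s).
Proof. by move=> hs _ /mapP[p ps ->]; exact: (hs p). Qed.

Lemma simple_fun_nil x : sf [::] x = 0.
Proof. by rewrite /simple_fun big_nil. Qed.

Lemma simple_fun_cons p s x : sf (p :: s) x = (\1_(p.1) x : R) *: p.2 + sf s x.
Proof. by rewrite /simple_fun big_cons. Qed.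

Lemma simple_fun_cat s1 s2 x : sf (s1 ++ s2) x = sf s1 x + sf s2 x.
Proof. by rewrite /simple_fun big_cat. Qed.

Lemma simple_fun_opp s x : sf (opp_steps s) x = - sf s x.
Proof.
by rewrite /simple_fun big_map -sumrN; apply: eq_bigr => p _; rewrite scalerN.
Qed.

Lemma simple_integralB s1 s2 : I (s1 ++ opp_steps s2) = I s1 - I s2.
Proof.
rewrite /simple_integral big_cat/=; congr (_ + _).
by rewrite big_map -sumrN; apply: eq_bigr => p _; rewrite scalerN.
Qed.

Lemma measurable_fun_sub_simple f s : integrable_steps s ->
  measurable_fun D (f : T -> borel H) ->
  measurable_fun D ((fun x => f x - sf s x) : T -> borel H).
Proof.
elim: s f => [|p s IH] f.
  by move=> _; under [X in _ -> measurable_fun D X]eq_fun do rewrite simple_fun_nil subr0.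
move=> /integrable_steps_cons[[mp _] hs] mf.
under eq_fun do rewrite simple_fun_cons opprD addrA.
by apply: IH => //; exact: measurable_fun_sub_indic.
Qed.

Lemma measurable_fun_simple s : integrable_steps s ->
  measurable_fun D (sf s : T -> borel H).
Proof.
move=> /integrable_steps_opp hs.
have := @measurable_fun_sub_simple (cst 0) _ hs (measurable_cst _).
by under eq_fun do rewrite simple_fun_opp sub0r opprK.
Qed.

Lemma indic_integrable A (k : R) : measurable A -> (mu (D `&` A) < +oo)%E ->
  mu.-integrable D (EFin \o (fun x => \1_A x * k)).
Proof.
move=> mA Aoo.
rewrite [X in _.-integrable _ X](_ : _ = (fun x => k%:E * (\1_A x)%:E)%E); last first.
  by apply/funext => x /=; rewrite mulrC.
apply: integrableZl => //; apply/integrableP; split.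
  exact/measurable_EFinP/measurable_indic.
under eq_integral do rewrite gee0_abs ?lee_fin//.
by rewrite integral_indic// setIC.
Qed.

Lemma simple_norm_integrable s : integrable_steps s ->
  mu.-integrable D (fun x => (`|sf s x|)%:E).
Proof.
move=> hs; apply: (@le_integrable _ _ _ mu D mD _
    (fun x => (\sum_(p <- s) (\1_(p.1) x * `|p.2|))%:E)).
- exact/measurable_EFinP/measurable_fun_norm_borel/measurable_fun_simple.
- move=> x _; rewrite lee_fin normr_id /simple_fun ger0_norm; last first.
    by apply: sumr_ge0 => p _; rewrite mulr_ge0.
  apply: le_trans (ler_norm_sum _ _ _) _; apply: ler_sum => p _.
  by rewrite normrZ ger0_norm.
elim: s hs => [|p s IH].
  by move=> _; under eq_fun do rewrite big_nil; exact: integrable0.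
move=> /integrable_steps_cons[[mp poo] /IH hs].
under eq_fun do rewrite big_cons EFinD.
by apply: integrableD => //; exact: indic_integrable.
Qed.

Definition dist_simple f s := (\int[mu]_(x in D) (`|f x - sf s x|)%:E)%E.

Lemma measurable_dist_simple f s : measurable_fun D (f : T -> borel H) ->
  integrable_steps s -> measurable_fun D (fun x => (`|f x - sf s x|)%:E : \bar R).
Proof.
move=> mf hs.
exact/measurable_EFinP/measurable_fun_norm_borel/measurable_fun_sub_simple.
Qed.

Lemma norm_integrable f s : measurable_fun D (f : T -> borel H) ->
  integrable_steps s -> (dist_simple f s < +oo)%E ->
  mu.-integrable D (fun x => (`|f x|)%:E).
Proof.
move=> mf hs foo.
apply: (@le_integrable _ _ _ mu D mD _
    ((fun x => (`|f x - sf s x|)%:E) \+ (fun x => (`|sf s x|)%:E))).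
- exact/measurable_EFinP/measurable_fun_norm_borel.
- move=> x _ /=; rewrite lee_fin normr_id ger0_norm; last by rewrite addr_ge0.
  by have := ler_normD (f x - sf s x) (sf s x); rewrite subrK.
- apply: integrableD => //; last exact: simple_norm_integrable.
  apply/integrableP; split; first exact: measurable_dist_simple.
  by under eq_integral do rewrite gee0_abs ?lee_fin//.
Qed.

Variable ip : {dot H for idfun}.
Hypothesis hip : induces_norm ip.

Lemma ip_integrable f h : measurable_fun D (f : T -> borel H) ->
  mu.-integrable D (fun x => (`|f x|)%:E) ->
  mu.-integrable D (EFin \o (fun x => ip (f x) h)).
Proof.
move=> mf fi.
apply: (@le_integrable _ _ _ mu D mD _ (fun x => (`|h|%:E * (`|f x|)%:E)%E)).
- apply/measurable_EFinP.
  apply: (@measurable_fun_comp_continuous _ _ _ _ D f (fun x => ip x h)) => //.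
  exact: ip_continuousl.
- move=> x _ /=; rewrite lee_fin [leRHS]ger0_norm ?mulr_ge0// mulrC.
  exact: ler_norm_ip.
- exact: integrableZl.
Qed.

Lemma simple_pairing s h : integrable_steps s ->
  \int[mu]_(x in D) ip (sf s x) h = ip (I s) h.
Proof.
elim: s => [|p s IH] hs.
  rewrite /simple_integral big_nil ip0l.
  under eq_Rintegral do rewrite simple_fun_nil ip0l.
  by rewrite Rintegral_cst// mul0r.
have /integrable_steps_cons[[mp poo] hs'] := hs.
rewrite /simple_integral big_cons -/(I s) ipDl -IH// ipZl.
under eq_Rintegral do rewrite simple_fun_cons ipDl ipZl.
rewrite RintegralD//; last 2 first.
- exact: indic_integrable.
- apply: ip_integrable; [exact: measurable_fun_simple|exact: simple_norm_integrable].
congr (_ + _).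
under eq_Rintegral do rewrite -[\1_ _ _]mulr1.
under eq_Rintegral do rewrite mulrC.
rewrite RintegralZl//; last exact: indic_integrable.
rewrite mulrC; congr (_ * _).
under eq_Rintegral do rewrite mulr1.
by rewrite /Rintegral integral_indic// setIC.
Qed.

(** Since the sets of [s] may overlap, the bound cannot be read off the sum. Pairing with [I s]
    itself and Cauchy-Schwarz give |I s|^2 <= |I s| times the integral of the norm. *)
Lemma norm_simple_integral s : integrable_steps s ->
  (`|I s|%:E <= \int[mu]_(x in D) (`|sf s x|)%:E)%E.
Proof.
move=> hs; have si := simple_norm_integrable hs.
have mS := measurable_fun_simple hs.
rewrite -(fineK (integrable_fin_num mD si)) lee_fin.
rewrite -/(Rintegral mu D (fun x => `|sf s x|)).
have J0 : 0 <= \int[mu]_(x in D) `|sf s x| by exact: Rintegral_ge0.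
have [->|I0] := eqVneq (I s) 0; first by rewrite normr0.
rewrite -(@ler_pM2r _ `|I s|) ?normr_gt0// -expr2 -hip -simple_pairing//.
rewrite -RintegralZr//; apply: le_Rintegral => //.
- exact: ip_integrable.
- rewrite [X in _.-integrable _ X](_ : _ = (fun x => (`|I s|%:E * (`|sf s x|)%:E)%E)).
    exact: integrableZl.
  by apply/funext => x /=; rewrite mulrC.
- by move=> x _; exact: ler_ip.
Qed.

Lemma simple_integral_dist f s1 s2 : measurable_fun D (f : T -> borel H) ->
  integrable_steps s1 -> integrable_steps s2 ->
  ((`|I s1 - I s2|)%:E <= dist_simple f s1 + dist_simple f s2)%E.
Proof.
move=> mf h1 h2; rewrite -simple_integralB.
have h12 := integrable_steps_cat h1 (integrable_steps_opp h2).
apply: le_trans (norm_simple_integral h12) _.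
rewrite -ge0_integralD//; last 2 first.
- exact: measurable_dist_simple.
- exact: measurable_dist_simple.
apply: ge0_le_integral => //.
- exact/measurable_EFinP/measurable_fun_norm_borel/measurable_fun_simple.
- by apply: emeasurable_funD; exact: measurable_dist_simple.
move=> x _; rewrite -EFinD lee_fin simple_fun_cat simple_fun_opp.
have := ler_normD (sf s1 x - f x) (f x - sf s2 x).
by rewrite subrKA (distrC _ (f x)).
Qed.

(** The integrals of approximations with errors 1/(n+1) form a Cauchy sequence by
    [simple_integral_dist], and completeness of [H] supplies the value. *)
Lemma bochner_integrableP f : measurable_fun D (f : T -> borel H) ->
  (forall e : R, 0 < e -> exists2 s, integrable_steps s & (dist_simple f s <= e%:E)%E) ->
  bochner_integrable mu D f.
Proof.
move=> mf approx.
have /choice[s sP] : forall n : nat, exists s,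
    integrable_steps s /\ (dist_simple f s <= n.+1%:R^-1%:E)%E.
  move=> n; have [|s hs fs] := approx n.+1%:R^-1; first by rewrite invr_gt0.
  by exists s.
have I_dist m n : `|I (s m) - I (s n)| <= m.+1%:R^-1 + n.+1%:R^-1.
  have [hm fm] := sP m; have [hn fn] := sP n.
  rewrite -lee_fin EFinD; apply: le_trans (simple_integral_dist mf hm hn) _.
  exact: leeD.
have I_cvg : cvg (I (s n) @[n --> \oo]).
  apply/cauchy_cvgP/cauchyP => e e0.
  have [N _ HN] := near_infty_natSinv_lt (PosNum (divr_gt0 e0 (ltr0Sn R 1))).
  exists (I (s N)).
  suff: \forall n \near \oo, ball (I (s N)) e (I (s n)) by [].
  near=> n; rewrite -ball_normE /ball_/=; apply: le_lt_trans (I_dist _ _) _.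
  have nN : (N <= n)%N by near: n; exact: nbhs_infty_ge.
  have /= := HN N (leqnn _); have /= := HN n nN.
  move: (N.+1%:R^-1) (n.+1%:R^-1) => a b; lra.
exists (lim (I (s n) @[n --> \oo])); split=> //; exists s; split=> //.
  by move=> k p ps; have [hs _] := sP k; exact: hs.
apply: (@squeeze_cvge _ _ _ _ (cst 0%E) _ (fun n => n.+1%:R^-1%:E)).
- near=> n; have [_ ->] := sP n.
  by rewrite andbT; apply: integral_ge0 => x _; rewrite lee_fin.
- exact: cvg_cst.
- by apply: cvg_EFin; [near=> n|exact: cvg_harmonic].
Unshelve. all: by end_near. Qed.

Lemma eq_bochner_integral f g v : {in D, f =1 g} ->
  is_bochner_integral mu D f v -> is_bochner_integral mu D g v.
Proof.
move=> fg [mf [s [hs fs sv]]]; split; first exact: eq_measurable_fun mf.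
exists s; split=> //; apply: cvg_trans fs; apply: near_eq_cvg; near=> k.
by apply: eq_integral => x xD; rewrite fg.
Unshelve. all: by end_near. Qed.

Lemma bochner_approximation f (e : R) : bochner_integrable mu D f -> 0 < e ->
  exists2 s, integrable_steps s & (dist_simple f s <= e%:E)%E.
Proof.
move=> [v [mf [s [hs fs _]]]] e0.
have /fine_cvgP[fin /cvgrPdist_le/(_ _ e0) fs0] := fs.
have [k [kfin kP]] := filter_ex (filterI fin fs0).
exists (s k); first by move=> p; exact: hs.
rewrite /dist_simple -(fineK kfin) lee_fin; move: kP; rewrite sub0r normrN; apply: le_trans.
exact: ler_norm.
Qed.

Lemma bochner_norm_integrable f : bochner_integrable mu D f ->
  mu.-integrable D (fun x => (`|f x|)%:E).
Proof.
move=> fi; have [s hs fs] := bochner_approximation fi ltr01.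
have [v [mf _]] := fi.
by apply: (norm_integrable mf hs); rewrite (le_lt_trans fs)// ltry.
Qed.

(** Holds for every admissible value [v], hence for the one chosen by [get]. It is the only channel
    through which Bochner integrals are used afterwards. *)
Lemma is_bochner_integral_pairing f v h : is_bochner_integral mu D f v ->
  ip v h = \int[mu]_(x in D) ip (f x) h.
Proof.
move=> fv; have fi : mu.-integrable D (fun x => (`|f x|)%:E).
  by apply: bochner_norm_integrable; exists v.
have [mf [s [hs fs sv]]] := fv.
have ipi := ip_integrable h mf fi.
have sh : (fun k => ip (I (s k)) h) @ \oo --> (ip v h : R) by exact: cvg_ipl.
apply/esym/(@cvg_unique _ (@Rhausdorff R) _ _ _ _ _ sh).
have /fine_cvgP[fin /= fs0] := fs.
apply/cvgrPdist_le => e e0.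
have hh : 0 < e / (`|h| + 1) by rewrite divr_gt0// ltr_wpDl.
have /cvgrPdist_le/(_ _ hh) := fs0 => fs1.
near=> k.
have hk : integrable_steps (s k) by move=> p; exact: hs.
have mk := measurable_fun_simple hk.
have ik := simple_norm_integrable hk.
rewrite -simple_pairing// -RintegralB//; last exact: ip_integrable.
have mB : measurable_fun D ((fun x => f x - sf (s k) x) : T -> borel H).
  exact: measurable_fun_sub_simple.
have kfin : dist_simple f (s k) \is a fin_num by near: k.
have iB : mu.-integrable D (fun x => (`|f x - sf (s k) x|)%:E).
  apply/integrableP; split; first exact/measurable_EFinP/measurable_fun_norm_borel.
  under eq_integral do rewrite gee0_abs ?lee_fin//.
  by case/fin_numPlt/andP: kfin.
under eq_Rintegral do rewrite -ipBl.
have iipB := ip_integrable h mB iB.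
apply: le_trans (le_normr_Rintegral mD iipB) _.
apply: (@le_trans _ _ (\int[mu]_(x in D) (`|f x - sf (s k) x| * `|h|))).
  apply: le_Rintegral => //.
  - exact: integrable_abse iipB.
  - rewrite [X in _.-integrable _ X](_ : _ = (fun x => (`|h|%:E * (`|f x - sf (s k) x|)%:E)%E)).
      exact: integrableZl.
    by apply/funext => x /=; rewrite mulrC.
  - by move=> x _; exact: ler_norm_ip.
rewrite RintegralZr//.
have : `|0 - fine (dist_simple f (s k))| <= e / (`|h| + 1) by near: k; exact: fs1.
rewrite sub0r normrN ger0_norm; last first.
  by apply: Rintegral_ge0 => x _.
rewrite ler_pdivlMr ?ltr_wpDl//; apply: le_trans.
rewrite -/(Rintegral mu D _) ler_wpM2l ?lerDl//.
by apply: Rintegral_ge0.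
Unshelve. all: by end_near. Qed.

Lemma bochner_integral_pairing f h : bochner_integrable mu D f ->
  ip (bochner_integral mu D f) h = \int[mu]_(x in D) ip (f x) h.
Proof.
move=> fi; apply: is_bochner_integral_pairing.
by have /getPex := fi.
Qed.

Lemma bochner_ip_integrable f h : bochner_integrable mu D f ->
  mu.-integrable D (EFin \o (fun x => ip (f x) h)).
Proof.
move=> fi; apply: ip_integrable; last exact: bochner_norm_integrable.
by case: fi => v [].
Qed.

End bochner.

(* Borel(D x H) is generated by rectangles because the line is second
   countable; no separability of [H] is needed. *)
Lemma measurable_kernel (R : realType) (H : completeNormedModType R)
    (D : set R) (G : R -> H -> H) (f : R -> H) (M : R) :
  measurable D -> 0 < M ->
  (forall u x y, D u -> `|G u x - G u y| <= M * `|x - y|) ->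
  (forall x, continuous (G ^~ x)) ->
  measurable_fun D (f : R -> borel H) ->
  measurable_fun D ((fun u => G u (f u)) : R -> borel H).
Proof.
move=> mD M0 GM Gc mf; apply: measurable_fun_borel => // U oU.
(* The set [V q r] collects every open [W] that [G u] sends into [U] for all times [u] of [D]
   between [q] and [r]. An arbitrary union of open sets is open, so countability is only asked of
   the rational endpoints. *)
pose Vs (q r : R) : set (set H) := [set W | open W /\
  forall u z, D u -> q < u < r -> W z -> U (G u z)].
pose V q r : set H := \bigcup_(W in Vs q r) W.
have oV q r : open (V q r) by apply: bigcup_open => W [].
have -> : D `&` (fun u => G u (f u)) @^-1` U =
    \bigcup_(q : rat) \bigcup_(r : rat)
      (`]ratr q, ratr r[ `&` (D `&` f @^-1` (V (ratr q) (ratr r)))).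
  apply/seteqP; split=> u /=; last first.
    move=> [q _ [r _]] [/=]; rewrite in_itv/= => qur [Du [W [_ WU] Wf]].
    by split=> //; exact: WU.
  move=> [Du Uu].
  have : nbhs (G u (f u)) U by exact: open_nbhs_nbhs.
  move=> /nbhs_normP[e /= e0 eU].
  have e2 : 0 < e / 2 by rewrite divr_gt0.
  have /cvgrPdist_lt/(_ _ e2)/nbhs_normP[dl /= dl0 dlP] := Gc (f u) u.
  have [q] := @rat_in_itvoo R (u - dl) u ltac:(lra).
  have [r] := @rat_in_itvoo R u (u + dl) ltac:(lra).
  rewrite !in_itv/= => /andP[ur rd] /andP[dq qu].
  exists q => //; exists r => //; split=> /=; first by rewrite in_itv/= qu.
  split=> //; exists (ball (f u) (e / 2 / M)); last by apply: ballxx; rewrite divr_gt0.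
  split; first exact: ball_open.
  move=> v z Dv /andP[qv vr]; rewrite -ball_normE /ball_/= => zf; apply: eU => /=.
  have h1 : `|G u (f u) - G v (f u)| < e / 2.
    by apply: dlP => /=; rewrite ltr_norml; lra.
  have h2 : `|G v (f u) - G v z| < e / 2.
    by apply: le_lt_trans (GM _ _ _ Dv) _; rewrite mulrC -ltr_pdivlMr.
  have := ler_normD (G u (f u) - G v (f u)) (G v (f u) - G v z).
  rewrite subrKA; lra.
apply: bigcupT_measurable_rat => q; apply: bigcupT_measurable_rat => r.
apply: measurableI => //; apply: mf => //; exact: open_borel.
Qed.

Section bochner_interval.
Context {R : realType} {H : completeNormedModType R}.
Variable ip : {dot H for idfun}.
Hypothesis hip : induces_norm ip.
Local Notation mu := (@lebesgue_measure R).
Local Notation sf := (@simple_fun R H R).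

Lemma uniformly_continuous_itv (f : R -> H) (a b e : R) : continuous f -> 0 < e ->
  exists2 d, 0 < d & forall x y, a <= x <= b -> `|x - y| < d -> `|f x - f y| < e.
Proof.
move=> cf e0; have e2 : 0 < e / 2 by rewrite divr_gt0.
pose P (d x : R) := forall y, `|x - y| < d -> `|f x - f y| < e.
have h : \forall d \near 0^'+, `[a, b] `<=` P d.
  apply: ((compact_near_coveringP _).1 (@segment_compact R a b) R _ P) => x _.
  have /cvgrPdist_lt/(_ _ e2)/nbhs_normP[dl /= dl0 dlP] := cf x.
  have dl2 : 0 < dl / 2 by rewrite divr_gt0.
  near=> x' d => y /= xy.
  have x1 : `|x - x'| < dl / 2.
    by near: x'; apply: (@cvgr_dist_lt _ _ _ (nbhs x) _ id x).
  have d1 : d < dl / 2 by near: d; exact: nbhs_right_lt.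
  have h1 : `|f x - f x'| < e / 2 by apply: dlP => /=; lra.
  have h2 : `|f x - f y| < e / 2.
    apply: dlP => /=; have := ler_normD (x - x') (x' - y); rewrite subrKA; lra.
  have h3 : `|f x' - f x| < e / 2 by rewrite distrC.
  rewrite /=; have := ler_normD (f x' - f x) (f x - f y); rewrite subrKA; lra.
have [d [d0 dP]] := filter_ex (filterI (nbhs_right_gt (0 : R)) h).
exists d => // x y xab; apply: dP => /=; by rewrite in_itv.
Unshelve. all: by end_near. Qed.

(** On a bounded interval the finiteness part of [integrable_steps] is automatic, and this form does
    not mention the interval. *)
Definition measurable_steps (s : seq (set R * H)) :=
  forall p, p \in s -> measurable (p.1 : set R).

Lemma measurable_steps_itv a b s : measurable_steps s ->
  integrable_steps mu `[a, b] s.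
Proof.
move=> hs p ps; split; first exact: hs.
apply: (@le_lt_trans _ _ (mu `[a, b])).
  by apply: le_measure; rewrite ?inE//; apply: measurableI => //; exact: hs.
by rewrite lebesgue_measure_itv/=; case: ifP => _; rewrite ltry.
Qed.

Lemma continuous_steps (f : R -> H) (a b e : R) : continuous f -> 0 < e ->
  exists2 s, measurable_steps s &
    forall x, a <= x <= b -> `|f x - sf s x| <= e.
Proof.
move=> cf e0; have [d d0 dP] := uniformly_continuous_itv a b cf e0.
(* Half-open cells of width d / 2 are disjoint, so exactly one, found by truncation, contains [x];
   [n] has one cell beyond the truncation so that the endpoint [b] is covered. *)
pose w := d / 2; have w0 : 0 < w by rewrite divr_gt0.
pose A (k : nat) : set R := `[a + k%:R * w, a + k.+1%:R * w[%classic.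
pose n := (Num.truncn ((b - a) / w)).+1.
pose s := [seq (A k, f (a + k%:R * w)) | k <- iota 0 n].
have As (k : nat) x : A k x <-> k%:R <= (x - a) / w < k.+1%:R.
  by rewrite /A /= in_itv/= ler_pdivlMr// ltr_pdivrMr//; split; lra.
exists s; first by move=> p /mapP[k _ ->]; exact: measurable_itv.
move=> x xab; pose k0 := Num.truncn ((x - a) / w).
have xa0 : 0 <= (x - a) / w by rewrite divr_ge0 ?(ltW w0)// subr_ge0; case/andP: xab.
have k0n : (k0 < n)%N.
  rewrite ltnS; apply: le_truncn; rewrite ler_pM2r ?invr_gt0//; lra.
have Ak0 : A k0 x by apply/As; exact: truncn_itv.
have -> : sf s x = f (a + k0%:R * w).
  rewrite /simple_fun /s big_map (bigD1_seq k0) ?iota_uniq ?mem_iota//=.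
  rewrite indicE mem_set// scale1r big1 ?addr0// => k kk0.
  rewrite indicE memNset ?scale0r// => /As/truncn_def kE.
  by move: kk0; rewrite -kE eqxx.
apply/ltW/dP => //.
move: Ak0; rewrite /A/= in_itv/= -addn1 natrD mulrDl mul1r => Ak0.
have wd : w < d by rewrite /w; lra.
rewrite ltr_norml; lra.
Qed.

(** The quantity |b - a| + 1 dominates the length whatever the order of the endpoints, and is
    positive, so errors can be divided by it. *)
Lemma integral_cst_itv_le (a b c : R) : 0 <= c ->
  (\int[mu]_(x in `[a, b]) (cst c%:E) x <= (c * (`|b - a| + 1))%:E)%E.
Proof.
move=> c0; rewrite (integral_cst mu (measurable_itv `[a, b]) c%:E) EFinM.
apply: lee_wpmul2l => //.
have : (lebesgue_measure `[a, b]%classic <= (`|b - a| + 1)%:E :> \bar R)%E.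
  rewrite lebesgue_measure_itv/=; case: ifP => _; last by rewrite lee_fin addr_ge0.
  by rewrite -EFinD lee_fin (le_trans (ler_norm _))// lerDl.
exact.
Qed.

Lemma continuous_bochner_integrable (f : R -> H) (a b : R) : continuous f ->
  bochner_integrable mu `[a, b] f.
Proof.
move=> cf.
have mf : measurable_fun `[a, b] (f : R -> borel H).
  apply: measurable_fun_borel => // U oU; apply: measurableI => //.
  by apply: open_measurable; move/continuousP : cf; exact.
apply: (@bochner_integrableP _ _ _ _ mu `[a, b]%classic (measurable_itv _) ip hip).
  exact: mf.
move=> e e0.
have K0 : 0 < `|b - a| + 1 by rewrite ltr_wpDl.
have [s ms sP] := continuous_steps a b cf (divr_gt0 e0 K0).
have hs := measurable_steps_itv a b ms.
exists s => //; apply: (@le_trans _ _ (\int[mu]_(x in `[a, b]) (cst (e / (`|b - a| + 1))%:E) x)%E).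
  apply: ge0_le_integral => //.
  exact: (@measurable_dist_simple _ _ _ _ mu _ (measurable_itv _) f s mf hs).
apply: le_trans (integral_cst_itv_le a b _) _; first by rewrite divr_ge0// ltW.
by rewrite divfK// gt_eqF.
Qed.

Lemma simple_fun_restrict (A : set R) (s : seq (set R * H)) x :
  sf [seq (A `&` p.1, p.2) | p <- s] x = (\1_A x : R) *: sf s x.
Proof.
rewrite /simple_fun big_map scaler_sumr; apply: eq_bigr => p _ /=.
by rewrite indicI/= scalerA.
Qed.

Section kernel.
Variables (a b : R) (G : R -> H -> H) (M : R).
Hypothesis M0 : 0 < M.
Hypothesis G_linear : forall u, linear (G u).
Hypothesis G_bounded : forall u x, a <= u <= b -> `|G u x| <= M * `|x|.
Hypothesis G_continuous : forall x, continuous (G ^~ x).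

Let G0 u : G u 0 = 0.
Proof.
have := G_linear u 1 0 0; rewrite !scale1r addr0 => /eqP.
by rewrite -subr_eq subrr eq_sym => /eqP.
Qed.

Let GB u x y : G u (x - y) = G u x - G u y.
Proof. by rewrite addrC -scaleN1r G_linear scaleN1r addrC. Qed.

(** For one step, [G u] applied to 1_A(u) v is 1_A(u) G u v. The orbit of [v] is continuous, so
    uniformly close to a step function, which is then restricted to [A]. *)
Lemma kernel_steps s (e : R) : measurable_steps s -> 0 < e ->
  exists2 s', measurable_steps s' &
    forall u, a <= u <= b -> `|G u (sf s u) - sf s' u| <= e.
Proof.
elim: s e => [|p s IH] e ms e0.
  exists [::] => // u _; rewrite !simple_fun_nil G0 subr0 normr0; exact: ltW.
have e2 : 0 < e / 2 by rewrite divr_gt0.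
have mp : measurable p.1 by apply: ms; rewrite in_cons eqxx.
have [s1 ms1 s1P] := continuous_steps a b (@G_continuous p.2) e2.
have [|s2 ms2 s2P] := IH (e / 2) _ e2.
  by move=> q qs; apply: ms; rewrite in_cons qs orbT.
exists ([seq (p.1 `&` q.1, q.2) | q <- s1] ++ s2).
  move=> q; rewrite mem_cat => /orP[|/ms2//].
  by move=> /mapP[r /ms1 mr ->] /=; exact: measurableI.
move=> u uab; rewrite simple_fun_cons G_linear simple_fun_cat simple_fun_restrict.
rewrite opprD addrACA -scalerBr; apply: le_trans (ler_normD _ _) _.
have h : `|(\1_p.1 u : R) *: (G u p.2 - sf s1 u)| <= e / 2.
  rewrite normrZ; apply: le_trans (s1P u uab).
  rewrite ger0_norm// ler_piMl// indicE; by case: (_ \in _).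
have := s2P u uab; lra.
Qed.

(** Since [f] is merely integrable, two approximations are combined: [f] by steps in mean, with
    error (e / 2) / M because [G u] expands by at most [M], then the image of these steps by steps,
    uniformly on the interval. *)
Lemma kernel_bochner_integrable (f : R -> H) : bochner_integrable mu `[a, b] f ->
  bochner_integrable mu `[a, b] (fun u => G u (f u)).
Proof.
move=> fi; have [v [mf _]] := fi.
have mG : measurable_fun `[a, b] ((fun u => G u (f u)) : R -> borel H).
  apply: (@measurable_kernel _ _ _ _ _ M) => //.
  by move=> u x y; rewrite /= in_itv/= -GB; exact: G_bounded.
apply: (@bochner_integrableP _ _ _ _ mu `[a, b]%classic (measurable_itv _) ip hip) => //.
move=> e e0.
have K0 : 0 < `|b - a| + 1 by rewrite ltr_wpDl.
have e2 : 0 < e / 2 by rewrite divr_gt0.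
have [s hs fs] := bochner_approximation fi (divr_gt0 e2 M0).
have ms : measurable_steps s by move=> p /hs[].
have [s' ms' s'P] := kernel_steps ms (divr_gt0 e2 K0).
have hs' := measurable_steps_itv a b ms'; exists s' => //.
pose c := e / 2 / (`|b - a| + 1); have c0 : 0 <= c by rewrite !divr_ge0// ltW.
apply: (@le_trans _ _ (\int[mu]_(x in `[a, b]) (M%:E * (`|f x - sf s x|)%:E + c%:E))%E).
  apply: ge0_le_integral => //.
  - exact: (@measurable_dist_simple _ _ _ _ mu _ (measurable_itv _) (fun u => G u (f u)) s' mG hs').
  - apply: emeasurable_funD => //; apply: measurable_funeM.
    exact: (@measurable_dist_simple _ _ _ _ mu _ (measurable_itv _) f s mf hs).
  move=> u; rewrite /= in_itv/= => uab; rewrite -EFinM -EFinD lee_fin.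
  have := ler_normD (G u (f u) - G u (sf s u)) (G u (sf s u) - sf s' u).
  rewrite subrKA -GB => /le_trans; apply; apply: lerD; first exact: G_bounded.
  exact: s'P.
have mfs := @measurable_dist_simple _ _ _ _ mu _ (measurable_itv _) f s mf hs.
rewrite ge0_integralD//; last 2 first.
- by move=> x _; rewrite -EFinM lee_fin mulr_ge0// ltW.
- exact: measurable_funeM.
rewrite ge0_integralZl//; last by rewrite lee_fin ltW.
have -> : e%:E = (M%:E * (e / 2 / M)%:E + (e / 2)%:E)%E.
  by rewrite -EFinM -EFinD; congr (_%:E); rewrite mulrCA divff ?gt_eqF//; lra.
apply: leeD; first by rewrite lee_pmul2l.
apply: le_trans (integral_cst_itv_le a b c0) _.
by rewrite /c divfK// gt_eqF.
Qed.

End kernel.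

Lemma bochner_integrable_subitv (f : R -> H) (a b a' b' : R) :
  a <= a' -> b' <= b -> bochner_integrable mu `[a, b] f ->
  bochner_integrable mu `[a', b'] f.
Proof.
move=> aa bb fi; have [v [mf _]] := fi.
have sub : `[a', b']%classic `<=` `[a, b]%classic.
  by move=> x; rewrite /= !in_itv/=; lra.
have mf' : measurable_fun `[a', b'] (f : R -> borel H) by exact: measurable_funS mf.
apply: (@bochner_integrableP _ _ _ _ mu `[a', b']%classic (measurable_itv _) ip hip) => //.
move=> e e0; have [s hs fs] := bochner_approximation fi e0.
exists s.
  by apply: measurable_steps_itv => p /hs[].
apply: le_trans fs; apply: ge0_subset_integral => //.
exact: (@measurable_dist_simple _ _ _ _ mu _ (measurable_itv _) f s mf hs).
Qed.

(** The function [g] is the integrand as written in a definition, meaningful only on [a, b]; [f] is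
    its extension with truncated time, for which integrability has been proved. *)
Lemma bochner_itv_pairing (f g : R -> H) (a b : R) h :
  bochner_integrable mu `[a, b] f -> (forall u, a <= u <= b -> f u = g u) ->
  ip (bochner_integral mu `[a, b] g) h = \int[mu]_(u in `[a, b]) ip (f u) h.
Proof.
move=> fi fg.
have fgD : {in `[a, b]%classic, f =1 g} by move=> u; rewrite inE/= in_itv/=; exact: fg.
have gi : bochner_integrable mu `[a, b] g.
  by have [v fv] := fi; exists v; exact: eq_bochner_integral fv.
rewrite (@bochner_integral_pairing _ _ _ _ mu _ (measurable_itv _) ip hip g h gi).
by apply: eq_Rintegral => u uab; rewrite fgD.
Qed.

Lemma bochner_itv_ip_integrable (f : R -> H) (a b : R) h :
  bochner_integrable mu `[a, b] f ->
  mu.-integrable `[a, b] (EFin \o (fun u => ip (f u) h : R)).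
Proof. exact: (@bochner_ip_integrable _ _ _ _ mu _ (measurable_itv _) ip hip). Qed.

End bochner_interval.

(** * Covariance and drift integrals *)

Section mean_and_covariance.
Context {R : realType} {H : completeNormedModType R}.
Variable ip : {dot H for idfun}.
Hypothesis hip : induces_norm ip.
Variable S : R -> {linear H -> H}.
Hypothesis hS : C0_semigroup S.
Local Notation mu := (@lebesgue_measure R).
Local Notation Sa t := (adjoint ip ip (S t)).

Lemma S_jointly_continuous (z : R -> H) : continuous z ->
  continuous (fun u : R => S (Num.max 0 u) (z u)).
Proof.
move=> cz u0; have [M M0 SM] := semigroup_bounded hS (`|u0| + 1).
apply/cvgrPdist_lt => e e0.
have e2 : 0 < e / 2 by rewrite divr_gt0.
near=> u.
have u1 : `|u0 - u| < 1 by near: u; apply: (@cvgr_dist_lt _ _ _ (nbhs u0) _ id u0).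
have zu : `|z u0 - z u| < e / 2 / M.
  near: u; apply: (@cvgr_dist_lt _ _ _ (nbhs u0) _ z (z u0)); first exact: cz.
  exact: divr_gt0.
have Su : `|S (Num.max 0 u0) (z u0) - S (Num.max 0 u) (z u0)| < e / 2.
  near: u; apply: (@cvgr_dist_lt _ _ _ (nbhs u0) _ (fun u => S (Num.max 0 u) (z u0))) => //.
  exact: S_continuous.
have h : `|S (Num.max 0 u) (z u0) - S (Num.max 0 u) (z u)| < e / 2.
  rewrite -linearB; apply: le_lt_trans (SM _ _ _) _; last by rewrite mulrC -ltr_pdivlMr.
  rewrite le_max lexx /=; have := ler_norm u0; have := normr_ge0 u0; move: u1.
  by rewrite ltr_norml maxEle; case: ifP => _; lra.
have := ler_normD (S (Num.max 0 u0) (z u0) - S (Num.max 0 u) (z u0))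
  (S (Num.max 0 u) (z u0) - S (Num.max 0 u) (z u)).
rewrite subrKA; lra.
Unshelve. all: by end_near. Qed.

Section covariance.
Variable Q : {linear H -> H}.
Hypothesis Qc : continuous Q.
Hypothesis Q_sym : forall x y : H, ip (Q x) y = ip x (Q y).
Hypothesis Q_pos : forall x : H, 0 <= ip (Q x) x.

Let integrand h u := S (Num.max 0 u) (Q (Sa (Num.max 0 u) h)).

Let integrand_continuous h : continuous (integrand h).
Proof.
apply: S_jointly_continuous => u.
exact: (continuous_comp (@Sa_continuous _ _ _ hS _ hip h u) (@Qc _)).
Qed.

Lemma cov_int_pairing r h k : ip (cov_int ip S Q r h) k =
  \int[mu]_(u in `[0, r]) (ip (integrand h u) k : R).
Proof.
have fi := continuous_bochner_integrable hip 0 r (@integrand_continuous h).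
apply: (bochner_itv_pairing hip k fi) => u /andP[u0 _].
by rewrite /integrand max_r.
Qed.

Let pairing_continuous h k : continuous (fun u => ip (integrand h u) k : R).
Proof.
move=> u; apply: (@cvg_ipl _ _ ip hip _ (nbhs u)); exact: integrand_continuous.
Qed.

Let pairing_integrable h k r :
  mu.-integrable `[0, r] (EFin \o (fun u => ip (integrand h u) k : R)).
Proof. exact: continuous_itv_integrable. Qed.

Let max0 (u : R) : 0 <= Num.max 0 u.
Proof. by rewrite le_max lexx. Qed.

Lemma cov_int_sym r h k : ip (cov_int ip S Q r h) k = ip (cov_int ip S Q r k) h.
Proof.
apply: etrans (cov_int_pairing r h k) _.
apply: etrans (esym (cov_int_pairing r k h)); apply: eq_Rintegral => u _.
rewrite /integrand (SaP hS hip _ k (max0 u)) (SaP hS hip _ h (max0 u)).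
by rewrite Q_sym ipC.
Qed.

Lemma cov_int_ge0 r h : 0 <= ip (cov_int ip S Q r h) h.
Proof.
by rewrite cov_int_pairing; apply: Rintegral_ge0 => u _; rewrite /integrand SaP.
Qed.

(** Since Q_r is an integral over [0, r] of an integrand independent of r, the two values differ by
    an integral over [t - s, t - s0], of length s - s0, of a function bounded on [0, t - s0]. *)
Lemma cov_int_cvg s0 t h k : s0 < t ->
  ip (cov_int ip S Q (t - s) h) k @[s --> s0^'+] -->
  (ip (cov_int ip S Q (t - s0) h) k : R).
Proof.
move=> s0t; pose phi u : R := ip (integrand h u) k.
have ts0 : 0 <= t - s0 by lra.
have [K phiK] : exists K, forall u, 0 <= u <= t - s0 -> `|phi u| <= K.
  have [c _ cP] := @EVT_max R (fun u => `|phi u|) 0 (t - s0) ts0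
    ltac:(by apply: continuous_subspaceT => u; apply: cvg_norm; exact: pairing_continuous).
  by exists `|phi c| => u ur; apply: cP; rewrite in_itv.
apply/cvgrPdist_lt => e e0.
have K1 : 0 < `|K| + 1 by rewrite ltr_wpDl.
near=> s.
have ss0 : s0 < s by near: s; exact: nbhs_right_gt.
have st : s < t by near: s; exact: nbhs_right_lt.
have se : s - s0 < e / (`|K| + 1).
  rewrite ltrBlDl; near: s; apply: nbhs_right_lt; rewrite ltrDl; exact: divr_gt0.
have ts : 0 <= t - s by lra.
have tst : t - s <= t - s0 by lra.
rewrite (cov_int_pairing (t - s0) h k) (cov_int_pairing (t - s) h k).
rewrite (Rintegral_itv_cat ts tst)// addrAC subrr add0r.
apply: le_lt_trans (le_Rintegral_itv (K := `|K| + 1) tst _ _) _.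
- apply: integrableS (pairing_integrable h k (t - s0)) => //= u /=.
  by rewrite !in_itv/=; lra.
- move=> u ur; apply: (@le_trans _ _ K); first by apply: phiK; lra.
  by rewrite (le_trans (ler_norm K))// lerDl.
- rewrite mulrC -ltr_pdivlMr//; lra.
Unshelve. all: by end_near. Qed.

End covariance.

Section drift.
Variable a : R -> H.
Hypothesis a_int : forall b, 0 <= b -> bochner_integrable mu `[0, b] a.

Let integrand t u := S (Num.max 0 (t - u)) (a u).

Let integrand_integrable s t : 0 <= s -> s <= t ->
  bochner_integrable mu `[s, t] (integrand t).
Proof.
move=> s0 st; have [M M0 SM] := semigroup_bounded hS t.
apply: (kernel_bochner_integrable hip M0 (G := fun u => S (Num.max 0 (t - u)))).
- by move=> u; exact: linearP.
- by move=> u x ur; apply: SM; rewrite maxEle; case: ifP => _; lra.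
- move=> x u; apply: (@continuous_comp _ _ _ (fun v : R => t - v) (fun v : R => S (Num.max 0 v) x)).
    by apply: cvgB; [exact: cvg_cst|exact: cvg_id].
  exact: S_continuous.
- by apply: (bochner_integrable_subitv hip s0 (lexx t)); apply: a_int; lra.
Qed.

Lemma drift_int_pairing s t h : 0 <= s -> s <= t ->
  ip (drift_int S a s t) h = \int[mu]_(u in `[s, t]) (ip (integrand t u) h : R).
Proof.
move=> s0 st; have fi := integrand_integrable s0 st.
apply: (bochner_itv_pairing hip h fi) => u /andP[_ ut].
by rewrite /integrand max_r// subr_ge0.
Qed.

(** The upper endpoint [t], and with it the integrand, stays fixed; moving [s] only removes the
    integral over [s0, s]. As the trajectory may be unbounded, continuity of the integral in its
    endpoint is used instead of a sup bound. *)
Lemma drift_int_cvg s0 t h : 0 <= s0 -> s0 < t ->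
  ip (drift_int S a s t) h @[s --> s0^'+] --> (ip (drift_int S a s0 t) h : R).
Proof.
move=> s00 s0t; pose psi u : R := ip (integrand t u) h.
have psii : mu.-integrable `[s0, t] (EFin \o psi).
  apply: (bochner_itv_ip_integrable hip).
  by apply: integrand_integrable => //; exact: ltW.
have int0 : parameterized_integral mu s0 s psi @[s --> s0^'+] --> (0 : R).
  by apply: cvg_at_right_filter; exact: (parameterized_integral_cvg_left s0t psii).
have : ip (drift_int S a s0 t) h - parameterized_integral mu s0 s psi
    @[s --> s0^'+] --> (ip (drift_int S a s0 t) h - 0 : R).
  by apply: cvgB int0; exact: cvg_cst.
rewrite subr0; apply: cvg_trans; apply: near_eq_cvg; near=> s.
have ss0 : s0 <= s by near: s; exact: nbhs_right_ge.
have st : s <= t by near: s; exact: nbhs_right_le.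
rewrite !drift_int_pairing ?(le_trans s00)//; last exact: ltW.
rewrite /parameterized_integral (Rintegral_itv_cat ss0 st)//.
by rewrite addrAC subrr add0r.
Unshelve. all: by end_near. Qed.

End drift.

End mean_and_covariance.

(** * Integrability of multiples and differences of real functions *)

Section real_integrable.
Context d (T : measurableType d) (R : realType).
Variables (mu : {measure set T -> \bar R}) (D : set T).
Hypothesis mD : measurable D.
Implicit Types f g : T -> R.

Lemma integrable_scale f (k : R) : mu.-integrable D (EFin \o f) ->
  mu.-integrable D (EFin \o (fun x => k * f x)).
Proof.
move=> fi.
rewrite (_ : _ \o _ = (fun x => k%:E * (EFin \o f) x)%E); last exact/funext.
exact: integrableZl.
Qed.

Lemma integrable_sub f g : mu.-integrable D (EFin \o f) ->
  mu.-integrable D (EFin \o g) -> mu.-integrable D (EFin \o (fun x => f x - g x)).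
Proof.
move=> fi gi.
rewrite (_ : _ \o _ = (fun x => (EFin \o f) x - (EFin \o g) x)%E); last exact/funext.
exact: integrableB.
Qed.

End real_integrable.

(** * The one-dimensional Gaussian Fourier transform *)

Section gaussian_weight.
Context {R : realType}.
Local Notation mu := (@lebesgue_measure R).

(** Over growing symmetric intervals the integral equals a difference of boundary values of [h],
    which decay like 1 / |x - m|; dominated convergence identifies the limit. *)
Lemma Rintegral_derive_eq0 (h k : R -> R) (m K : R) :
  (forall x : R, is_derive x 1 h (k x)) -> continuous k ->
  mu.-integrable setT (EFin \o k) ->
  (forall x, `|h x| * `|x - m| <= K) ->
  \int[mu]_x k x = 0.
Proof.
move=> hk kc ki hK.
have hc : continuous h.
  move=> x; apply/differentiable_continuous/derivable1_diffP.
  by have [] := hk x.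
(* Using [n.+1] keeps the interval nondegenerate, as the fundamental theorem of calculus
   requires. *)
pose B (n : nat) : set R := `[- n.+1%:R, n.+1%:R]%classic.
have FTC n : (\int[mu]_(x in B n) (k x)%:E)%E =
    (h n.+1%:R - h (- n.+1%:R))%:E.
  rewrite (continuous_FTC2 (F := h)) ?EFinB//.
  - by rewrite gtrN.
  - exact: continuous_subspaceT.
  - split.
    + by move=> x _; have [] := hk x.
    + exact/cvg_at_right_filter/hc.
    + exact/cvg_at_left_filter/hc.
  - by move=> x _; rewrite derive1E; have [_ ->] := hk x.
have lim1 : (\int[mu]_(x in B n) (k x)%:E)%E @[n --> \oo] -->
    (\int[mu]_x (k x)%:E)%E.
  under eq_fun do rewrite integral_mkcond.
  apply: (@dominated_cvg _ _ _ mu setT measurableT _ _ (fun x => `|(k x)%:E|%E)).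
  - move=> n; apply/(measurable_restrictT _ _).1; first exact: measurable_itv.
    apply: (@measurable_funS _ _ _ _ setT) => //; exact: measurable_int ki.
  - move=> x _; apply: cvg_near_cst; near=> n; rewrite patchE ifT// inE /B /= in_itv/=.
    rewrite -ler_norml; apply: (@le_trans _ _ n%:R); last by rewrite ler_nat.
    by apply/ltW; near: n; exact: nbhs_infty_gtr.
  - by [].
  - exact: integrable_abse ki.
  - by move=> n x _; rewrite patchE; case: ifPn => // _; rewrite abse0.
have lim2 : (h n.+1%:R - h (- n.+1%:R))%:E @[n --> \oo] --> (0 : \bar R)%E.
  have far (y : nat -> R) : (forall r, \forall n \near \oo, r < `|y n - m|) ->
      h (y n) @[n --> \oo] --> (0 : R).
    move=> yoo; apply/cvgrPdist_lt => e e0.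
    near=> n; rewrite sub0r normrN.
    have yn : `|K| / e < `|y n - m| by near: n; exact: yoo.
    have y0 : 0 < `|y n - m| by apply: le_lt_trans yn; rewrite divr_ge0// ltW.
    rewrite -(ltr_pM2r y0); apply: le_lt_trans (hK _) _.
    by rewrite mulrC; apply: le_lt_trans (ler_norm K) _; rewrite -ltr_pdivrMr.
  have -> : (0 : \bar R)%E = (0 - 0 : R)%:E by rewrite subr0.
  apply: cvg_EFin; first by near=> n.
  apply: cvgB; apply: far => r; near=> n.
  - have : r + `|m| < n%:R by near: n; exact: nbhs_infty_gtr.
    have := ler_norm m; have := ler_norm (n.+1%:R - m).
    by rewrite -natr1; lra.
  - have : r + `|m| < n%:R by near: n; exact: nbhs_infty_gtr.
    have := ler_norm (- m); have := ler_norm (- (- n.+1%:R - m)); rewrite !normrN.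
    by rewrite -natr1; lra.
have : (\int[mu]_x (k x)%:E)%E = 0%E.
  apply: (cvg_unique (@ereal_hausdorff R) lim1).
  apply: cvg_trans lim2; apply: near_eq_cvg; near=> n; exact/esym/FTC.
by rewrite /Rintegral => ->.
Unshelve. all: by end_near. Qed.

(** The unnormalised density of N(m, 1/p): [p] is a precision, the one-dimensional case of the
    matrix [P] of the Fourier weights. *)
Definition gauss_weight (p m x : R) : R := expR (- (p / 2 * (x - m) ^+ 2)).

Lemma gauss_weightE p m x : 0 < p ->
  gauss_weight p m x = Num.sqrt (2 * pi / p) * normal_pdf m (Num.sqrt p^-1) x.
Proof.
move=> p0; have s0 : Num.sqrt p^-1 != 0 :> R by rewrite sqrtr_eq0 -ltNge invr_gt0.
rewrite normal_pdfE// /normal_peak /normal_fun sqr_sqrtr ?invr_ge0 ?ltW//.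
have -> : p^-1 * pi *+ 2 = 2 * pi / p :> R by rewrite -mulr_natr; ring.
rewrite mulrA divff ?mul1r; last first.
  by rewrite sqrtr_eq0 -ltNge divr_gt0// mulr_gt0// pi_gt0.
congr expR; rewrite -[p^-1 *+ 2]mulr_natr invfM invrK; by field.
Qed.

Lemma gauss_weight_gt0 p m x : 0 < gauss_weight p m x.
Proof. exact: expR_gt0. Qed.

Lemma is_derive_gauss_weight p m (x : R) :
  is_derive x 1 (gauss_weight p m) (- (p * (x - m)) * gauss_weight p m x).
Proof.
have -> : gauss_weight p m = expR \o (fun x => - (p / 2 * (x - m) ^+ 2)) by [].
apply: is_derive_eq; by rewrite /= /GRing.scale/= /gauss_weight; field.
Qed.

Lemma continuous_gauss_weight p m : continuous (gauss_weight p m).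
Proof.
move=> x; apply/differentiable_continuous/derivable1_diffP.
by have [] := is_derive_gauss_weight p m x.
Qed.

Lemma gauss_weight_integrable p m : 0 < p ->
  mu.-integrable setT (EFin \o gauss_weight p m).
Proof.
move=> p0; rewrite (_ : _ \o _ = (fun x => (Num.sqrt (2 * pi / p))%:E *
    (normal_pdf m (Num.sqrt p^-1) x)%:E)%E); last first.
  by apply/funext => x /=; rewrite gauss_weightE.
by apply: integrableZl => //; exact: integrable_normal_pdf.
Qed.

Lemma Rintegral_gauss_weight p m : 0 < p ->
  \int[mu]_x gauss_weight p m x = Num.sqrt (2 * pi / p).
Proof.
move=> p0; under eq_Rintegral do rewrite gauss_weightE//.
rewrite RintegralZl//; last exact: integrable_normal_pdf.
by rewrite /Rintegral integral_normal_pdf mulr1.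
Qed.

(** Half of the exponent absorbs the factor |t|, t = x - m: exp(p t^2 / 4) >= 1 + p t^2 / 4, and
    multiplying by 1 + 4 / p gives at least 1 + t^2 >= |t|. It yields both integrability of first
    moments and decay of boundary terms. *)
Lemma gauss_weight_moment p m x : 0 < p ->
  `|x - m| * gauss_weight p m x <= (1 + 4 / p) * gauss_weight (p / 2) m x.
Proof.
move=> p0; have -> : gauss_weight p m x =
    gauss_weight (p / 2) m x * gauss_weight (p / 2) m x.
  by rewrite /gauss_weight -expRD; congr expR; field.
rewrite mulrA ler_pM2r ?gauss_weight_gt0//.
rewrite /gauss_weight expRN -ler_pdivlMr ?invr_gt0 ?expR_gt0// invrK.
set t := x - m.
have e1 : 1 + p / 2 / 2 * t ^+ 2 <= expR (p / 2 / 2 * t ^+ 2) by exact: expR_ge1Dx.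
have c0 : 0 <= 4 / p by rewrite divr_ge0// ltW.
apply: le_trans (ler_wpM2l _ e1); last by rewrite addr_ge0.
have -> : (1 + 4 / p) * (1 + p / 2 / 2 * t ^+ 2) =
    1 + 4 / p + p / 4 * t ^+ 2 + t ^+ 2 by field; rewrite gt_eqF.
have : `|t| <= 1 + t ^+ 2 by rewrite -[t ^+ 2]real_normK ?num_real//; nra.
have : 0 <= p / 4 * t ^+ 2 by rewrite mulr_ge0 ?sqr_ge0// divr_ge0// ltW.
lra.
Qed.

Lemma bounded_gauss_integrable p m (f : R -> R) : 0 < p -> continuous f ->
  (forall x, `|f x| <= 1) ->
  mu.-integrable setT (EFin \o (fun x => f x * gauss_weight p m x)).
Proof.
move=> p0 cf f1; apply: le_integrable (gauss_weight_integrable m p0) => //.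
  apply/measurable_EFinP; apply: continuous_measurable_fun => x.
  by apply: cvgM; [exact: cf|exact: continuous_gauss_weight].
move=> x _ /=; rewrite lee_fin normrM ler_piMl//.
Qed.

Lemma bounded_gauss_moment_integrable p m (f : R -> R) : 0 < p -> continuous f ->
  (forall x, `|f x| <= 1) ->
  mu.-integrable setT (EFin \o (fun x => (x - m) * f x * gauss_weight p m x)).
Proof.
move=> p0 cf f1; have p2 : 0 < p / 2 by rewrite divr_gt0.
apply: (@le_integrable _ _ _ mu setT measurableT _
   (fun x => (1 + 4 / p)%:E * (EFin \o gauss_weight (p / 2) m) x)%E).
- apply/measurable_EFinP; apply: continuous_measurable_fun => x.
  apply: cvgM; last exact: continuous_gauss_weight.
  by apply: cvgM; [apply: cvgB; [exact: cvg_id|exact: cvg_cst]|exact: cf].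
- move=> x _ /=; rewrite lee_fin [leRHS]ger0_norm; last first.
    by rewrite mulr_ge0 ?(ltW (gauss_weight_gt0 _ _ _))// addr_ge0// divr_ge0// ltW.
  apply: le_trans (gauss_weight_moment m x p0).
  rewrite !normrM (gtr0_norm (gauss_weight_gt0 _ _ _)).
  by rewrite ler_pM2r ?gauss_weight_gt0// ler_piMr.
- by apply: integrableZl => //; exact: gauss_weight_integrable.
Qed.

(* Both sides solve [y' = - (c / p) y]: differentiate under the integral sign
   and integrate by parts. *)
Lemma Rintegral_cos_gauss_centered p m A c : 0 < p ->
  \int[mu]_x (cos (A + c * (x - m)) * gauss_weight p m x) =
  Num.sqrt (2 * pi / p) * expR (- (c ^+ 2 / (2 * p))) * cos A.
Proof.
move=> p0.
pose f (c x : R) : R := cos (A + c * (x - m)) * gauss_weight p m x.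
pose g (c x : R) : R := sin (A + c * (x - m)).
have cphase c' : continuous (fun x : R => A + c' * (x - m)).
  move=> x; apply: cvgD; first exact: cvg_cst.
  apply: cvgM; first exact: cvg_cst.
  by apply: cvgB; [exact: cvg_id|exact: cvg_cst].
have ccos c' : continuous (fun x : R => cos (A + c' * (x - m))).
  by move=> x; apply: continuous_comp; [exact: cphase|exact: continuous_cos].
have csin c' : continuous (g c').
  by move=> x; apply: continuous_comp; [exact: cphase|exact: continuous_sin].
have cos1 c' x : `|cos (A + c' * (x - m))| <= 1 by exact: cos_max.
have sin1 c' x : `|g c' x| <= 1 by exact: sin_max.
have fi c' : mu.-integrable setT (EFin \o f c') by exact: bounded_gauss_integrable.
have gi c' : mu.-integrable setT (EFin \o (fun x => (x - m) * g c' x * gauss_weight p m x)).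
  exact: bounded_gauss_moment_integrable.
have df (x c' : R) : is_derive c' 1 (f ^~ x) (- ((x - m) * g c' x * gauss_weight p m x)).
  by apply: is_derive_eq; rewrite /GRing.scale/= /g; ring.
pose F (c : R) : R := \int[mu]_x f c x.
have parts (c' : R) : \int[mu]_x ((x - m) * g c' x * gauss_weight p m x) = c' / p * F c'.
  have : \int[mu]_x (c' * f c' x - p * ((x - m) * g c' x * gauss_weight p m x)) = 0.
    apply: (@Rintegral_derive_eq0 (fun x => g c' x * gauss_weight p m x) _ m (1 + 4 / p)).
    - move=> x; have := is_derive_gauss_weight p m x => dw.
      by apply: is_derive_eq; rewrite /GRing.scale/= /f /g; ring.
    - move=> x; apply: cvgB; apply: cvgM; try exact: cvg_cst.
        by apply: cvgM; [exact: ccos|exact: continuous_gauss_weight].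
      apply: cvgM; last exact: continuous_gauss_weight.
      by apply: cvgM; [apply: cvgB; [exact: cvg_id|exact: cvg_cst]|exact: csin].
    - by apply: integrable_sub => //; exact: integrable_scale.
    - move=> x; apply: (@le_trans _ _ (`|x - m| * gauss_weight p m x)).
        rewrite normrM (gtr0_norm (gauss_weight_gt0 _ _ _)) mulrC.
        by rewrite ler_wpM2l// ler_piMl// ltW// gauss_weight_gt0.
      apply: le_trans (gauss_weight_moment m x p0) _.
      rewrite ler_piMr//; first by rewrite addr_ge0// divr_ge0// ltW.
      by rewrite -[leRHS]expR0 ler_expR oppr_le0 mulr_ge0 ?sqr_ge0// !divr_ge0// ltW.
  rewrite RintegralB//; last 2 first.
  - exact: integrable_scale.
  - exact: integrable_scale.
  rewrite !RintegralZl// => /eqP; rewrite subr_eq0 => /eqP e1.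
  by rewrite /F mulrAC e1 mulrAC divff ?mul1r// gt_eqF.
have dF (c' : R) : is_derive c' 1 F (- (c' / p * F c')).
  (* As |sin| <= 1, this bounds the derivative in the frequency independently of the frequency. *)
  pose G (x : R) : R := `|x - m| * gauss_weight p m x.
  have Gi : mu.-integrable setT (EFin \o G).
    have i1 : mu.-integrable setT (EFin \o (fun x => (x - m) * 1 * gauss_weight p m x)).
      apply: (@bounded_gauss_moment_integrable p m (cst 1)) => //.
        exact: cst_continuous.
      by move=> x; rewrite normr1.
    apply: eq_integrable (integrable_abse i1) => // x _.
    by rewrite /= mulr1 normrM /G (gtr0_norm (gauss_weight_gt0 _ _ _)).
  have c'I : `]c' - 1, c' + 1[%classic c' by rewrite /= in_itv/=; lra.
  have dfE x y : partial1of2 f x y = - ((y - m) * g x y * gauss_weight p m y).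
    by rewrite partial1of2E; have [_ ->] := df y x.
  have der x y : derivable (f ^~ y) x 1 by have [] := df y x.
  have Gub x y : `]c' - 1, c' + 1[%classic x -> setT y -> `|partial1of2 f x y| <= G y.
    move=> _ _; rewrite dfE normrN !normrM (gtr0_norm (gauss_weight_gt0 _ _ _)).
    by rewrite ler_pM2r ?gauss_weight_gt0// ler_piMr.
  have G0 y : 0 <= G y by rewrite mulr_ge0// ltW// gauss_weight_gt0.
  have D := derivable_under_integral measurableT c'I (fun x _ => fi x)
    (fun x y _ _ => der x y) G0 Gi Gub.
  have E := differentiation_under_integral measurableT c'I (fun x _ => fi x)
    (fun x y _ _ => der x y) G0 Gi Gub.
  apply: DeriveDef => //; rewrite -derive1E E.
  under eq_Rintegral do rewrite dfE -mulN1r.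
  by rewrite RintegralZl// parts mulN1r.
(* The integrating factor makes the derivative zero; the constant is read off at frequency 0, where
   only the total mass of the weight remains. *)
pose u (c' : R) : R := expR (c' ^+ 2 / (2 * p)) * F c'.
have u0 : forall x y : R, u x = u y.
  move=> x y; apply: is_derive_0_is_cst => c'; have dFc := dF c'.
  rewrite /u; apply: is_derive_eq; by rewrite /GRing.scale/=; field; rewrite gt_eqF.
have := u0 c 0; rewrite /u expr0n/= mul0r expR0 mul1r {2}/F.
under eq_Rintegral do rewrite /f mul0r addr0.
rewrite RintegralZl//; last exact: gauss_weight_integrable.
rewrite Rintegral_gauss_weight// => E.
have -> : \int[mu]_x (cos (A + c * (x - m)) * gauss_weight p m x) =
    expR (- (c ^+ 2 / (2 * p))) * (expR (c ^+ 2 / (2 * p)) * F c).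
  by rewrite mulrA -expRD addNr expR0 mul1r.
by rewrite E; ring.
Qed.

Lemma Rintegral_cos_gauss p b A c : 0 < p ->
  mu.-integrable setT (EFin \o (fun x => cos (A + c * x) * expR (- (p / 2 * x ^+ 2 + b * x))))
  /\ \int[mu]_x (cos (A + c * x) * expR (- (p / 2 * x ^+ 2 + b * x))) =
     Num.sqrt (2 * pi / p) * expR ((b ^+ 2 - c ^+ 2) / (2 * p)) * cos (A - c * b / p).
Proof.
(* Completing the square: p x^2 / 2 + b x = p (x - m)^2 / 2 - b^2 / (2 p) with m = - b / p. *)
move=> p0; pose m := - b / p; pose A' := A + c * m.
have E x : cos (A + c * x) * expR (- (p / 2 * x ^+ 2 + b * x)) =
    expR (b ^+ 2 / (2 * p)) * (cos (A' + c * (x - m)) * gauss_weight p m x).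
  rewrite [RHS]mulrCA /gauss_weight -expRD /A' -addrA -mulrDr (addrC m) subrK; congr (_ * expR _).
  by rewrite /m; field; rewrite gt_eqF.
have i1 : mu.-integrable setT (EFin \o (fun x => cos (A' + c * (x - m)) * gauss_weight p m x)).
  apply: bounded_gauss_integrable => //; last by move=> x; exact: cos_max.
  move=> x; apply: (@continuous_comp _ _ _ (fun x : R => A' + c * (x - m)) cos); last exact: continuous_cos.
  apply: cvgD; first exact: cvg_cst.
  apply: cvgM; first exact: cvg_cst.
  by apply: cvgB; [exact: cvg_id|exact: cvg_cst].
split.
  by under eq_fun do rewrite E; exact: integrable_scale.
under eq_Rintegral do rewrite E.
rewrite RintegralZl// Rintegral_cos_gauss_centered//.
have -> : A' = A - c * b / p by rewrite /A' /m; ring.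
have -> : (b ^+ 2 - c ^+ 2) / (2 * p) = b ^+ 2 / (2 * p) + - (c ^+ 2 / (2 * p)).
  by rewrite mulrBl.
rewrite expRD; ring.
Qed.

End gaussian_weight.

(** * Gaussian densities as Fourier integrals *)

Section cvdot.
Context {R : realType}.

Lemma cvdotE d (u v : 'cV[R]_d) : cvdot u v = \sum_i u i 0 * v i 0.
Proof. by rewrite /cvdot mxE; apply: eq_bigr => i _; rewrite mxE. Qed.

Lemma cvdotC d (u v : 'cV[R]_d) : cvdot u v = cvdot v u.
Proof. by rewrite !cvdotE; apply: eq_bigr => i _; rewrite mulrC. Qed.

Lemma cvdotDl d (u v w : 'cV[R]_d) : cvdot (u + v) w = cvdot u w + cvdot v w.
Proof. by rewrite /cvdot linearD/= mulmxDl mxE. Qed.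

Lemma cvdotDr d (u v w : 'cV[R]_d) : cvdot w (u + v) = cvdot w u + cvdot w v.
Proof. by rewrite cvdotC cvdotDl !(cvdotC w). Qed.

Lemma cvdotZl d k (u v : 'cV[R]_d) : cvdot (k *: u) v = k * cvdot u v.
Proof. by rewrite /cvdot linearZ/= -scalemxAl mxE. Qed.

Lemma cvdotZr d k (u v : 'cV[R]_d) : cvdot u (k *: v) = k * cvdot u v.
Proof. by rewrite cvdotC cvdotZl cvdotC. Qed.

Lemma cvdotBl d (u v w : 'cV[R]_d) : cvdot (u - v) w = cvdot u w - cvdot v w.
Proof. by rewrite cvdotDl -scaleN1r cvdotZl mulN1r. Qed.

Lemma cvdotBr d (u v w : 'cV[R]_d) : cvdot w (u - v) = cvdot w u - cvdot w v.
Proof. by rewrite cvdotC cvdotBl !(cvdotC w). Qed.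

Lemma cvdot0l d (v : 'cV[R]_d) : cvdot 0 v = 0.
Proof. by rewrite /cvdot trmx0 mul0mx mxE. Qed.

Lemma cvdot_trmx d e (u : 'cV[R]_d) (M : 'M[R]_(d, e)) (v : 'cV[R]_e) :
  cvdot u (M *m v) = cvdot (M^T *m u) v.
Proof. by rewrite /cvdot trmx_mul trmxK mulmxA. Qed.

Lemma cvdot_col_mx d e (u u' : 'cV[R]_d) (v v' : 'cV[R]_e) :
  cvdot (col_mx u v) (col_mx u' v') = cvdot u u' + cvdot v v'.
Proof. by rewrite /cvdot tr_col_mx mul_row_col mxE. Qed.

Lemma cvdot_scalar (x y : R) : cvdot x%:M y%:M = x * y :> R.
Proof. by rewrite cvdotE big_ord1 !mxE. Qed.

Lemma cvdot_delta d (u : 'cV[R]_d) i : cvdot u (delta_mx i 0) = u i 0.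
Proof.
rewrite cvdotE (bigD1 i)//= big1 ?addr0 ?mxE ?eqxx ?mulr1// => j ji.
by rewrite mxE (negbTE ji) mulr0.
Qed.

Lemma pos_def_unitmx d (P : 'M[R]_d) : pos_def P -> P \in unitmx.
Proof.
move=> [Psym Ppos]; rewrite unitmxE unitfE; apply/det0P => -[v v0 vP].
have := Ppos v^T; rewrite trmx_eq0 => /(_ v0).
rewrite cvdot_trmx Psym -[P in P *m _]Psym -trmx_mul vP trmx0 cvdot0l ltxx//.
Qed.

Lemma pos_def_block d e (A : 'M[R]_d) (B : 'M[R]_e) :
  pos_def A -> pos_def B -> pos_def (block_mx A 0 0 B).
Proof.
move=> [As Ap] [Bs Bp]; split; first by rewrite tr_block_mx !trmx0 As Bs.
move=> u; rewrite -[u]vsubmxK; set v := usubmx u; set w := dsubmx u => u0.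
rewrite mul_block_col !mul0mx addr0 add0r cvdot_col_mx.
have [v0|v0] := eqVneq v 0.
  rewrite v0 cvdot0l add0r; apply: Bp; apply: contraNneq u0 => ->.
  by rewrite v0 col_mx0.
have [->|w0] := eqVneq w 0; first by rewrite cvdot0l addr0; exact: Ap.
by rewrite addr_gt0// ?Ap// Bp.
Qed.

Lemma pos_defD_psd d (A B : 'M[R]_d) : pos_def A -> B^T = B ->
  (forall u, 0 <= cvdot u (B *m u)) -> pos_def (A + B).
Proof.
move=> [As Ap] Bs Bp; split; first by rewrite linearD/= As Bs.
by move=> u u0; rewrite mulmxDl cvdotDr ltr_wpDr// Ap.
Qed.

Lemma sym_block_mx d (P : 'M[R]_(1 + d)) : P^T = P ->
  exists p q P', P = block_mx p%:M q^T q P' :> 'M[R]_(1 + d).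
Proof.
move=> Ps; exists (ulsubmx P 0 0), (dlsubmx P), (drsubmx P).
rewrite -[LHS]submxK; congr block_mx; first exact: mx11_scalar.
by rewrite trmx_dlsub Ps.
Qed.

Lemma col_mx_scalarP d (c : 'cV[R]_(1 + d)) :
  exists c1 c', c = col_mx c1%:M c' :> 'cV[R]_(1 + d).
Proof.
exists (usubmx c 0 0), (dsubmx c); rewrite -[LHS]vsubmxK; congr col_mx.
exact: mx11_scalar.
Qed.

(** * Schur complement of the first coordinate *)

Section schur.
Variables (d : nat) (p : R) (q : 'cV[R]_d) (P : 'M[R]_d).
Let B : 'M[R]_(1 + d) := block_mx p%:M q^T q P.
Let C := P - p^-1 *: (q *m q^T).

Lemma block_quadratic x (u : 'cV[R]_d) :
  cvdot (col_mx x%:M u) (B *m col_mx x%:M u) =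
  p * x ^+ 2 + 2 * (x * cvdot q u) + cvdot u (P *m u).
Proof.
rewrite mul_block_col cvdot_col_mx mul_scalar_mx !cvdotDr.
have -> : cvdot u (q *m x%:M) = x * cvdot q u.
  by rewrite mul_mx_scalar cvdotZr cvdotC.
have -> : cvdot x%:M (q^T *m u) = x * cvdot q u.
  have -> : q^T *m u = (cvdot q u)%:M by exact: mx11_scalar.
  by rewrite cvdot_scalar.
rewrite cvdotZr cvdot_scalar; ring.
Qed.

Lemma schur_quadratic (u : 'cV[R]_d) :
  cvdot u (C *m u) = cvdot u (P *m u) - cvdot q u ^+ 2 / p.
Proof.
rewrite mulmxBl cvdotBr -scalemxAl cvdotZr -mulmxA.
have -> : q^T *m u = (cvdot q u)%:M by exact: mx11_scalar.
by rewrite mul_mx_scalar cvdotZr (cvdotC u q); ring.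
Qed.

Hypothesis Bpos : pos_def B.

Lemma schur_pivot : 0 < p.
Proof.
have [_ Bp] := Bpos; have := Bp (col_mx 1%:M 0); rewrite block_quadratic.
rewrite mulmx0 cvdot0l cvdotC cvdot0l mulr0 mulr0 !addr0 expr1n mulr1; apply.
rewrite col_mx_eq0 negb_and; apply/orP; left; apply/eqP => /matrixP/(_ 0 0).
by rewrite !mxE => /eqP; rewrite oner_eq0.
Qed.

Lemma schur_pos_def : pos_def C.
Proof.
have p0 := schur_pivot; have [Bs Bp] := Bpos; split.
  move: Bs; rewrite tr_block_mx => /eq_block_mx[_ _ _ Ps].
  by rewrite linearB/= Ps linearZ/= trmx_mul trmxK.
(* For fixed [u], this first coordinate minimises the quadratic form of [B], and the minimum is the
   quadratic form of [C]. *)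
move=> u u0; have := Bp (col_mx (- (cvdot q u / p))%:M u).
rewrite block_quadratic schur_quadratic => h.
have -> : cvdot u (P *m u) - cvdot q u ^+ 2 / p =
   p * (- (cvdot q u / p)) ^+ 2 + 2 * (- (cvdot q u / p) * cvdot q u) +
   cvdot u (P *m u) by field; rewrite gt_eqF.
by apply: h; rewrite col_mx_eq0 negb_and u0 orbT.
Qed.

Lemma schur_det : \det B = p * \det C.
Proof.
have p0 := schur_pivot.
have -> : B = block_mx 1%:M 0 (p^-1 *: q) 1%:M *m block_mx p%:M q^T 0 C.
  rewrite mulmx_block !mul1mx !mul0mx !addr0 -scalemxAl mul_mx_scalar scalerA mulVf ?gt_eqF// scale1r.
  by rewrite -scalemxAl /C addrC subrK.
by rewrite det_mulmx det_lblock det_ublock !det1 !mul1r det_scalar1.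
Qed.

(** Eliminating the first unknown from B x = (c1, c) leaves C x' = c - (c1 / p) q. The right-hand
    side has the form produced when a Gaussian wave is integrated over its first coordinate. *)
Lemma schur_inverse (c1 : R) (c : 'cV[R]_d) :
  cvdot (col_mx c1%:M c) (invmx B *m col_mx c1%:M c) =
  c1 ^+ 2 / p + cvdot (c - (c1 / p) *: q) (invmx C *m (c - (c1 / p) *: q)).
Proof.
have p0 := schur_pivot; have pn : p != 0 by rewrite gt_eqF.
have Bu := pos_def_unitmx Bpos; have Cu := pos_def_unitmx schur_pos_def.
set x := invmx B *m col_mx c1%:M c.
have Bx : B *m x = col_mx c1%:M c by rewrite mulKVmx.
rewrite -[x]vsubmxK in Bx *.
set x1 := usubmx x 0 0; set x' := dsubmx x.
have x1E : usubmx x = x1%:M by exact: mx11_scalar.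
move: Bx; rewrite x1E -/x' mul_block_col => /eq_col_mx[e1 e2].
have {}e1 : p * x1 + cvdot q x' = c1.
  move/matrixP/(_ 0 0): e1; rewrite mul_scalar_mx !mxE eqxx !mulr1n => <-.
  by rewrite /cvdot mxE.
have Cx : C *m x' = c - (c1 / p) *: q.
  rewrite mulmxBl -scalemxAl -mulmxA.
  have -> : q^T *m x' = (cvdot q x')%:M by exact: mx11_scalar.
  rewrite mul_mx_scalar scalerA -e2 mul_mx_scalar.
  have -> : c1 / p = x1 + p^-1 * cvdot q x' by rewrite -e1; field.
  by rewrite scalerDl opprD addrA (addrC (x1 *: q)) addrK.
rewrite -Cx mulKmx// Cx cvdot_col_mx cvdot_scalar cvdotBl cvdotZl -e1.
by field.
Qed.

End schur.

End cvdot.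

(** * Products of sigma-finite measures *)

Section sigma_finite_product.
Context d1 d2 (T1 : measurableType d1) (T2 : measurableType d2) (R : realType).
Variables (m1 : {sigma_finite_measure set T1 -> \bar R})
  (m2 : {sigma_finite_measure set T2 -> \bar R}).

Lemma product_measure_sigma_finite : sigma_finite setT (m1 \x m2)%E.
Proof.
have /sigma_finiteP[F [TF ndF Foo]] := sigma_finiteT m1.
have /sigma_finiteP[G [TG ndG Goo]] := sigma_finiteT m2.
exists (fun n => F n `*` G n).
  apply/seteqP; split=> // -[x y] _.
  have [i _ Fix] : (\bigcup_n F n) x by rewrite -TF.
  have [j _ Gjy] : (\bigcup_n G n) y by rewrite -TG.
  exists (maxn i j) => //; split.
    by move: Fix; apply/subsetPset/ndF/leq_maxl.
  by move: Gjy; apply/subsetPset/ndG/leq_maxr.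
move=> n; have [mF Fn] := Foo n; have [mG Gn] := Goo n.
split; first exact: measurableX.
by rewrite product_measure1E// lte_mul_pinfty// ge0_fin_numE.
Qed.

(** Packaged as a sigma-finite measure so that Tonelli and Fubini apply again at the next
    dimension. *)
Definition sigma_finite_product : {sigma_finite_measure set (T1 * T2)%type -> \bar R} :=
  HB.pack (m1 \x m2)%E
    (Measure_isSigmaFinite.Build _ _ _ (m1 \x m2)%E product_measure_sigma_finite).

End sigma_finite_product.

Section fourier.
Context {R : realType}.

(** The real part of a plane wave damped by a Gaussian. The free phase [A] stands in for complex
    exponentials: when one coordinate is integrated, the others enter as a phase. *)
Definition gauss_wave d (P : 'M[R]_d) (c : 'cV[R]_d) (A : R) (t : 'cV[R]_d) : R :=
  cos (A + cvdot c t) * expR (- (2^-1 * cvdot t (P *m t))).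

Lemma measurable_cvdot disp (T : measurableType disp) d (th : T -> 'cV[R]_d) (c : 'cV[R]_d) :
  (forall i, measurable_fun setT (fun t => th t i 0)) ->
  measurable_fun setT (fun t => cvdot c (th t)).
Proof.
move=> mth; under eq_fun do rewrite cvdotE.
by apply: measurable_sum => i; apply: measurable_funM.
Qed.

Lemma measurable_gauss_exp disp (T : measurableType disp) d (th : T -> 'cV[R]_d) P :
  (forall i, measurable_fun setT (fun t => th t i 0)) ->
  measurable_fun setT (fun t => expR (- (2^-1 * cvdot (th t) (P *m th t)))).
Proof.
move=> mth; apply: measurableT_comp => //; apply: measurableT_comp => //.
apply: measurable_funM => //; under eq_fun do rewrite cvdotE.
apply: measurable_sum => i; apply: measurable_funM => //.
under eq_fun do rewrite mxE.
by apply: measurable_sum => j; apply: measurable_funM.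
Qed.

Lemma measurable_gauss_wave disp (T : measurableType disp) d (th : T -> 'cV[R]_d) P c A :
  (forall i, measurable_fun setT (fun t => th t i 0)) ->
  measurable_fun setT (fun t => gauss_wave P c A (th t)).
Proof.
move=> mth; apply: measurable_funM; last exact: measurable_gauss_exp.
apply: measurableT_comp.
  by apply: continuous_measurable_fun; exact: continuous_cos.
by apply: measurable_funD => //; exact: measurable_cvdot.
Qed.

(* Stands for Lebesgue measure on R^d with [th] the identity; it is realised on an
   iterated product of lines, as column vectors carry no Lebesgue measure here. *)
Definition fourier_space d disp (T : measurableType disp)
    (la : {measure set T -> \bar R}) (th : T -> 'cV[R]_d) :=
  (forall i, measurable_fun setT (fun t => th t i 0)) /\
  forall P, pos_def P ->
    la.-integrable setT (EFin \o (fun t => expR (- (2^-1 * cvdot (th t) (P *m th t))))) /\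
    forall c A, \int[la]_t gauss_wave P c A (th t) =
      Num.sqrt ((2 * pi) ^+ d / \det P) * expR (- (2^-1 * cvdot c (invmx P *m c))) * cos A.

Lemma fourier_space_wave_integrable d disp (T : measurableType disp)
    (la : {measure set T -> \bar R}) (th : T -> 'cV[R]_d) P c A :
  fourier_space la th -> pos_def P ->
  la.-integrable setT (EFin \o (fun t => gauss_wave P c A (th t))).
Proof.
move=> [mth h] /h[ei _]; apply: le_integrable ei => //.
  by apply/measurable_EFinP; exact: measurable_gauss_wave.
move=> t _ /=; rewrite lee_fin normrM ler_piMl//; exact: cos_max.
Qed.

(* The disintegration of [exp (- t^T P t / 2)] along the first coordinate is a
   Gaussian weight in [t_1] times the exponential of the Schur complement. *)
Lemma fourier_space_cons d disp (T : measurableType disp)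
    (la : {sigma_finite_measure set T -> \bar R}) (th : T -> 'cV[R]_d) :
  fourier_space la th ->
  fourier_space ((@lebesgue_measure R) \x la)%E
    ((fun z => col_mx z.1%:M (th z.2)) : _ -> 'cV[R]_(1 + d)).
Proof.
move=> hla; have [mth IH] := hla.
pose th' (z : measurableTypeR R * T) : 'cV[R]_(1 + d) := col_mx z.1%:M (th z.2).
have mth' i : measurable_fun setT (fun z => th' z i 0).
  have -> : (fun z => th' z i 0) = match fintype.split i with
      | inl _ => fst | inr j => fun z => th z.2 j 0 end.
    apply/funext => z; rewrite mxE; case: (fintype.split i) => // j.
    by rewrite mxE ord1 eqxx.
  case: (fintype.split i) => j; first exact: measurable_fst.
  exact: (measurableT_comp (mth j) measurable_snd).
split=> // P Ppos; have [p [q [P' PE]]] := sym_block_mx Ppos.1.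
rewrite {}PE in Ppos *.
have p0 := schur_pivot Ppos; have Cpos := schur_pos_def Ppos.
set C := P' - _ in Cpos.
have [ei Ci] := IH _ Cpos.
pose b t := cvdot q (th t).
pose e t := expR (- (2^-1 * cvdot (th t) (P' *m th t))).
pose B : 'M[R]_(1 + d) := block_mx p%:M q^T q P'.
have waveE c1 (c : 'cV[R]_d) A x t : gauss_wave B (col_mx c1%:M c) A (th' (x, t)) =
    e t * (cos ((A + cvdot c (th t)) + c1 * x) * expR (- (p / 2 * x ^+ 2 + b t * x))).
  rewrite /gauss_wave /th' /= block_quadratic cvdot_col_mx cvdot_scalar.
  rewrite [RHS]mulrCA -expRD /b; congr (cos _ * expR _); first ring.
  by field.
(* Integrating over x produces exp(b^2 / (2 p)), which turns [P'] into its Schur complement, and the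
   phase shift - c1 b / p, which turns [c] into c - (c1 / p) q. *)
have inner c1 (c : 'cV[R]_d) A t :
    (\int[@lebesgue_measure R]_x (gauss_wave B (col_mx c1%:M c) A (th' (x, t)))%:E)%E =
    (Num.sqrt (2 * pi / p) * expR (- (c1 ^+ 2 / (2 * p))) *
      gauss_wave C (c - (c1 / p) *: q) A (th t))%:E.
  have [wi wE] := Rintegral_cos_gauss (b t) (A + cvdot c (th t)) c1 p0.
  under eq_integral do rewrite waveE EFinM.
  rewrite integralZl// -(fineK (integrable_fin_num measurableT wi)) -EFinM.
  congr (_%:E); rewrite -[fine _]/(Rintegral _ _ _) wE /gauss_wave schur_quadratic.
  rewrite cvdotBl cvdotZl -/(b t) /e.
  have -> : A + (cvdot c (th t) - c1 / p * b t) = A + cvdot c (th t) - c1 * b t / p by ring.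
  have -> : (b t ^+ 2 - c1 ^+ 2) / (2 * p) = b t ^+ 2 / (2 * p) + - (c1 ^+ 2 / (2 * p)) by ring.
  have -> : - (2^-1 * (cvdot (th t) (P' *m th t) - b t ^+ 2 / p)) =
      - (2^-1 * cvdot (th t) (P' *m th t)) + b t ^+ 2 / (2 * p) by field; rewrite gt_eqF.
  by rewrite !expRD; ring.
have mexp : measurable_fun setT (fun z => expR (- (2^-1 * cvdot (th' z) (B *m th' z)))).
  exact: measurable_gauss_exp.
(* The positive exponential is itself a wave, of zero frequency and phase, so [inner] also computes
   the iterated integral needed for integrability. *)
have wave0 z : gauss_wave B (col_mx 0%:M 0) 0 (th' z) =
    expR (- (2^-1 * cvdot (th' z) (B *m th' z))).
  by rewrite /gauss_wave raddf0 col_mx0 cvdot0l addr0 cos0 mul1r.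
have Ei : ((@lebesgue_measure R) \x la)%E.-integrable setT
    (EFin \o (fun z => expR (- (2^-1 * cvdot (th' z) (B *m th' z))))).
  apply/integrable21ltyP; first exact/measurable_EFinP.
  have -> : (\int[la]_y \int[@lebesgue_measure R]_x
      `|(EFin \o (fun z => expR (- (2^-1 * cvdot (th' z) (B *m th' z))))) (x, y)|)%E =
    (\int[la]_y (Num.sqrt (2 * pi / p) * gauss_wave C 0 0 (th y))%:E)%E.
    apply: eq_integral => t _.
    have := inner 0 0 0 t; rewrite expr0n/= mul0r oppr0 expR0 mulr1 mul0r scale0r subr0.
    move=> <-; apply: eq_integral => x _ /=.
    by rewrite ger0_norm ?expR_ge0// wave0.
  apply: integrable_lty => //.
  exact: (integrable_scale measurableT _ (fourier_space_wave_integrable 0 0 hla Cpos)).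
split=> // c A; have [c1 [c' cE]] := col_mx_scalarP c; rewrite {}cE.
have Wi : ((@lebesgue_measure R) \x la)%E.-integrable setT
    (EFin \o (fun z => gauss_wave B (col_mx c1%:M c') A (th' z))).
  apply: le_integrable Ei => //.
    by apply/measurable_EFinP; exact: measurable_gauss_wave.
  by move=> t _ /=; rewrite lee_fin normrM ler_piMl//; exact: cos_max.
rewrite schur_inverse// schur_det// -/C.
have -> : \int[((@lebesgue_measure R) \x la)%E]_z gauss_wave B (col_mx c1%:M c') A (th' z) =
    \int[la]_t (Num.sqrt (2 * pi / p) * expR (- (c1 ^+ 2 / (2 * p))) *
      gauss_wave C (c' - (c1 / p) *: q) A (th t)).
  rewrite /Rintegral -integral21_prod_meas1//; congr fine.
  by apply: eq_integral => t _; rewrite -inner.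
rewrite RintegralZl//; last exact: fourier_space_wave_integrable.
rewrite Ci.
have -> : (2 * pi) ^+ (1 + d) / (p * \det C) = (2 * pi / p) * ((2 * pi) ^+ d / \det C).
  by rewrite exprS invfM; ring.
rewrite [in RHS]sqrtrM; last by rewrite divr_ge0 ?(ltW p0)// mulr_ge0 ?pi_ge0.
move: (cvdot _ (invmx C *m _)) => k.
have -> : - (2^-1 * (c1 ^+ 2 / p + k)) = - (c1 ^+ 2 / (2 * p)) + - (2^-1 * k).
  by field; rewrite gt_eqF.
by rewrite expRD; ring.
Qed.

Lemma fourier_space_exists d : exists disp (T : measurableType disp)
  (la : {sigma_finite_measure set T -> \bar R}) (th : T -> 'cV[R]_d),
  fourier_space la th.
Proof.
elim: d => [|d [disp [T [la [th h]]]]]; last first.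
  exists _, (measurableTypeR R * T)%type,
    (sigma_finite_product (@lebesgue_measure R) la).
  by exists (fun z => col_mx z.1%:M (th z.2)); exact: (fourier_space_cons h).
(* In dimension 0 the only vector is 0 and the determinant is 1, so a point mass satisfies the
   formula. *)
exists _, unit, (\d_tt : {sigma_finite_measure set unit -> \bar R}), (fun=> 0).
split=> [[]//|P _].
have E c A : gauss_wave P c A 0 = cos A.
  by rewrite /gauss_wave cvdotC !cvdot0l addr0 mulr0 oppr0 expR0 mulr1.
split.
  rewrite cvdot0l mulr0 oppr0 expR0.
  exact: finite_measure_integrable_cst.
move=> c A; rewrite /Rintegral integral_dirac// diracT mul1e /= E.
by rewrite det_mx00 expr0 divr1 sqrtr1 /cvdot (flatmx0 (invmx P)) mul0mx mulmx0 mxE mulr0 oppr0 expR0 !mul1r.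
Qed.

Lemma gauss_density_fourier d disp (T : measurableType disp)
    (la : {measure set T -> \bar R}) (th : T -> 'cV[R]_d) P y b :
  fourier_space la th -> pos_def P ->
  gauss_density y b P =
  ((2 * pi) ^+ d)^-1 * \int[la]_t gauss_wave P (y - b) 0 (th t).
Proof.
move=> [_ h] /h[_ ->]; rewrite cos0 mulr1 /gauss_density mulrC mulrA; congr (_ * _).
set k := (2 * pi) ^+ d.
have k0 : 0 < k by rewrite exprn_gt0// mulr_gt0// pi_gt0.
(* Hence the square root of k / det P is k over that of k det P, which explains the normalisation by
   1 / (2 pi)^d. *)
have -> : k / \det P = k ^+ 2 * (k * \det P)^-1.
  by rewrite invfM mulrA expr2 mulfK// gt_eqF.
rewrite [in RHS]sqrtrM ?sqr_ge0// sqrtr_sqr gtr0_norm// mulKf ?gt_eqF//.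
(* The sign of the determinant is not yet established; for a negative value both square roots are 0
   by convention, and so is the inverse. *)
have [x0|x0] := leP 0 (k * \det P); first by rewrite sqrtrV.
by rewrite !ltr0_sqrtr ?invr_lt0// invr0.
Qed.

End fourier.

(** * Integration against Gaussian measures *)

Section normal_characteristic_function.
Context {R : realType}.
Local Notation mu := (@lebesgue_measure R).

(** The normal law is defined as a measure; its Radon-Nikodym derivative agrees almost everywhere
    with the density, both having the same integral over every measurable set. *)
Lemma integral_normal_prob (m s : R) (f : R -> \bar R) :
  (normal_prob m s).-integrable setT f ->
  (\int[normal_prob m s]_x f x = \int[mu]_x (f x * (normal_pdf m s x)%:E))%E.
Proof.
move=> fi; have dom := normal_prob_dominates m s.
have mf := measurable_int _ fi.
have mpdf : measurable_fun setT (fun x => (normal_pdf m s x)%:E).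
  by apply/measurable_EFinP; exact: measurable_normal_pdf.
have RNi := @Radon_Nikodym_integrable _ _ _
  (charge_of_finite_measure (normal_prob m s)) mu dom.
rewrite -(Radon_Nikodym_change_of_variables dom)//.
apply: ae_eq_integral => //.
- by apply: emeasurable_funM => //; exact: measurable_int RNi.
- exact: emeasurable_funM.
- apply: ae_eqe_mul2l; apply: integral_ae_eq => //.
  by move=> E _ mE; rewrite -Radon_Nikodym_integral.
Qed.

Lemma cos_measurable (A c : R) : measurable_fun setT (fun x : R => cos (A + c * x)).
Proof.
apply: continuous_measurable_fun => x.
apply: (@continuous_comp _ _ _ (fun x : R => A + c * x) cos); last exact: continuous_cos.
apply: cvgD; first exact: cvg_cst.
by apply: cvgM; [exact: cvg_cst|exact: cvg_id].
Qed.

Lemma cos_integrable d (T : measurableType d) (P : probability T R)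
    (f : T -> R) : measurable_fun setT f ->
  P.-integrable setT (EFin \o (fun x => cos (f x))).
Proof.
move=> mf; apply: measurable_bounded_integrable => //.
  exact: le_lt_trans (probability_le1 P measurableT) (ltry 1).
  apply: measurableT_comp => //.
  by apply: continuous_measurable_fun; exact: continuous_cos.
exists 1; split => // M M1 x _; apply: le_trans (ltW M1); exact: cos_max.
Qed.

Lemma integral_cst_probability d (T : measurableType d) (P : probability T R) (c : R) :
  (\int[P]_x c%:E = c%:E)%E.
Proof.
by rewrite integral_cst//; have /= -> := probability_setT P; rewrite mule1.
Qed.

Lemma integral_cos_normal_prob (m v A c : R) : 0 < v ->
  (\int[normal_prob m (Num.sqrt v)]_x (cos (A + c * x))%:E)%E =
  (cos (A + c * m) * expR (- (2^-1 * (c ^+ 2 * v))))%:E.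
Proof.
move=> v0; have p0 : 0 < v^-1 by rewrite invr_gt0.
have s0 : 0 < Num.sqrt (2 * pi / v^-1) :> R.
  by rewrite sqrtr_gt0 divr_gt0// mulr_gt0// pi_gt0.
have ci : (normal_prob m (Num.sqrt v)).-integrable setT (fun x => (cos (A + c * x))%:E).
  apply: (@cos_integrable _ _ (normal_prob m (Num.sqrt v)) (fun x => A + c * x)).
  by apply: measurable_funD => //; exact: measurable_funM.
rewrite integral_normal_prob//.
pose F x : R := cos ((A + c * m) + c * (x - m)) * gauss_weight v^-1 m x.
have Fi : mu.-integrable setT (EFin \o F).
  apply: bounded_gauss_integrable => //; last by move=> x; exact: cos_max.
  move=> x; apply: (@continuous_comp _ _ _ (fun x : R => (A + c * m) + c * (x - m)) cos); last exact: continuous_cos.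
  apply: cvgD; first exact: cvg_cst.
  apply: cvgM; first exact: cvg_cst.
  by apply: cvgB; [exact: cvg_id|exact: cvg_cst].
transitivity (\int[mu]_x ((Num.sqrt (2 * pi / v^-1))^-1%:E * (F x)%:E))%E.
  apply: eq_integral => x _; rewrite -!EFinM /F gauss_weightE// invrK.
  rewrite invrK in s0; rewrite mulrCA mulKf ?gt_eqF//; congr (cos _ * _)%:E; ring.
rewrite integralZl// -(fineK (integrable_fin_num measurableT Fi)) -EFinM.
congr (_%:E); rewrite -[fine _]/(Rintegral _ _ _) Rintegral_cos_gauss_centered//.
rewrite -[X in _ * X]mulrA mulKf ?gt_eqF// mulrC; congr (_ * expR _); rewrite invf_div; field.
by rewrite ?gt_eqF.
Qed.

End normal_characteristic_function.

Section gaussian_integral.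
Context {R : realType} {H : completeNormedModType R}.
Variable ip : {dot H for idfun}.
Hypothesis hip : induces_norm ip.

Lemma measurable_ip (h : H) : measurable_fun setT ((fun u => ip u h) : borel H -> R).
Proof.
by apply: (@continuous_borel_measurable _ _ (ip^~ h)); exact: ip_continuousl.
Qed.

Variables (mu : probability (borel H) R) (m : H) (C : H -> H).
Hypothesis hmu : gaussian_measure ip mu m C.
Hypothesis C_ge0 : forall h, 0 <= ip (C h) h.

(** Pushing [mu] forward along the functional of [h] reduces to the line, where the hypothesis gives
    the law. Zero variance is treated apart because [normal_law] is then a Dirac mass. *)
Lemma integral_cos_gaussian_measure A h :
  (\int[mu]_u (cos (A + ip (u : H) h))%:E)%E =
  (cos (A + ip m h) * expR (- (2^-1 * ip (C h) h)))%:E.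
Proof.
pose phi (u : borel H) : measurableTypeR R := ip (u : H) h.
have mphi : measurable_fun setT phi by exact: measurable_ip.
have mcos : measurable_fun setT (fun x : R => (cos (A + x))%:E).
  apply/measurable_EFinP; have := cos_measurable A 1.
  by under eq_fun do rewrite mul1r.
have phiE B : measurable B -> pushforward mu phi B = normal_law (ip m h) (ip (C h) h) B.
  by move=> mB; exact: hmu.
transitivity (\int[pushforward mu phi]_x (cos (A + x))%:E)%E.
  rewrite integral_pushforward//= preimage_setT.
  have ms : measurable_fun setT (fun u => A + phi u) by exact: measurable_funD.
  exact: (cos_integrable mu ms).
have [v0|v0] := eqVneq (ip (C h) h) 0.
  transitivity (\int[\d_(ip m h : measurableTypeR R)]_x (cos (A + x))%:E)%E.
    apply: eq_measure_integral => B mB _.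
    by rewrite [LHS]phiE// /normal_law v0 eqxx.
  by rewrite integral_dirac// diracT mul1e v0 mulr0 oppr0 expR0 mulr1.
have vp : 0 < ip (C h) h by rewrite lt_neqAle eq_sym v0 C_ge0.
transitivity (\int[normal_prob (ip m h) (Num.sqrt (ip (C h) h))]_x (cos (A + x))%:E)%E.
  apply: eq_measure_integral => B mB _.
  by rewrite [LHS]phiE// /normal_law (negbTE v0).
have := integral_cos_normal_prob (ip m h) A 1 vp.
by under eq_integral do rewrite mul1r; rewrite mul1r expr1n mul1r.
Qed.

Variables (d : nat) (M : H -> 'cV[R]_d) (Ms : 'cV[R]_d -> H).
Hypothesis MsP : forall x th, cvdot (M x) th = ip x (Ms th).
Variable V : 'M[R]_d.
Hypothesis VP : forall th, cvdot th (V *m th) = ip (C (Ms th)) (Ms th).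
Hypothesis V_sym : V^T = V.

Lemma gauss_density_integral (P : 'M[R]_d) (y b : 'cV[R]_d) : pos_def P ->
  (\int[mu]_u (gauss_density y (M u + b) P)%:E)%E =
  (gauss_density y (M m + b) (P + V))%:E.
Proof.
move=> Ppos.
have PVpos : pos_def (P + V).
  by apply: pos_defD_psd => // u; rewrite VP; exact: C_ge0.
have [disp [T [la [th hla]]]] := @fourier_space_exists R d.
have [mth _] := hla.
have [ei _] := hla.2 P Ppos.
rewrite (gauss_density_fourier _ _ hla PVpos).
pose e t := expR (- (2^-1 * cvdot (th t) (P *m th t))).
pose F (z : borel H * T) : R :=
  cos (cvdot (y - b) (th z.2) - cvdot (M z.1) (th z.2)) * e z.2.
have FE u t : gauss_wave P (y - (M u + b)) 0 (th t) = F (u, t).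
  by rewrite /gauss_wave /F /e add0r [M u + b]addrC opprD addrA (cvdotBl (y - b)).
(* Each coordinate of [M] is a continuous functional, the pairing with M' e_i, hence Borel. *)
have mM i : measurable_fun setT ((fun u => M u i 0) : borel H -> R).
  under eq_fun do rewrite -cvdot_delta MsP; exact: measurable_ip.
have me : measurable_fun setT e by exact: measurable_gauss_exp.
have mF : measurable_fun setT F.
  apply: measurable_funM; last exact: measurableT_comp.
  apply: measurableT_comp.
    by apply: continuous_measurable_fun; exact: continuous_cos.
  apply: measurable_funB.
    by apply: measurable_cvdot => i; apply: (measurableT_comp (mth i)).
  under eq_fun do rewrite cvdotE.
  apply: measurable_sum => i; apply: measurable_funM.
    exact: (measurableT_comp (mM i)).
  exact: (measurableT_comp (mth i)).
have Fle z : `|F z| <= e z.2.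
  rewrite normrM [X in _ * X]gtr0_norm ?expR_gt0// ler_piMl ?expR_ge0//.
  exact: cos_max.
(* The bound by [e], which does not involve [u], is integrable in t, and [mu] has mass 1: this is
   what Fubini requires. *)
have Fi : (mu \x la)%E.-integrable setT (EFin \o F).
  apply/integrable21ltyP; first exact/measurable_EFinP.
  apply: (@le_lt_trans _ _ (\int[la]_t (e t)%:E)%E); last exact: integrable_lty.
  apply: ge0_le_integral => //.
  - by move=> t _; exact: integral_ge0.
  - apply: (measurable_fun_fubini_tonelli_G (abse \o (EFin \o F))) => //.
    by apply: measurableT_comp => //; exact/measurable_EFinP.
    by move=> z; exact: abse_ge0.
  - exact/measurable_EFinP.
  move=> t _; apply: (@le_trans _ _ (\int[mu]_u (e t)%:E)%E).
    apply: ge0_le_integral => //.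
    - apply: measurableT_comp => //; apply/measurable_EFinP.
      exact: (measurableT_comp mF (measurable_pair2 t)).
    - by move=> u _ /=; rewrite lee_fin; exact: (Fle (u, t)).
  by rewrite (integral_cst_probability mu).
have wi u : la.-integrable setT (EFin \o (fun t => gauss_wave P (y - (M u + b)) 0 (th t))).
  exact: fourier_space_wave_integrable.
transitivity (\int[mu]_u ((((2 * pi) ^+ d)^-1)%:E * \int[la]_t (F (u, t))%:E))%E.
  apply: eq_integral => u _; rewrite (gauss_density_fourier _ _ hla Ppos) EFinM.
  congr (_ * _)%E; rewrite /Rintegral fineK ?(integrable_fin_num measurableT (wi u))//.
  by apply: eq_integral => t _; rewrite FE.
rewrite integralZl//; last exact: (integrable_fubini_F Fi).
rewrite (Fubini Fi) EFinM; congr (_ * _)%E.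
have wi' : la.-integrable setT (EFin \o (fun t => gauss_wave (P + V) (y - (M m + b)) 0 (th t))).
  exact: fourier_space_wave_integrable.
rewrite /Rintegral fineK ?(integrable_fin_num measurableT wi')//.
apply: eq_integral => t _.
(* The signs are reversed because cosine is even and the lemma expects + <u, h>; the factor exp(- <C
   h, h> / 2) with h = M' theta adds [V] to [P]. *)
have := integral_cos_gaussian_measure (- cvdot (y - b) (th t)) (Ms (th t)).
transitivity ((e t)%:E * \int[mu]_u (cos (- cvdot (y - b) (th t) + ip (u : H) (Ms (th t))))%:E)%E.
  rewrite -integralZl//; last first.
    have ms : measurable_fun setT
        ((fun u => - cvdot (y - b) (th t) + ip (u : H) (Ms (th t))) : borel H -> R).
      by apply: measurable_funD => //; exact: measurable_ip.
    exact: (cos_integrable mu ms).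
  apply: eq_integral => u _; rewrite /F /= -EFinM mulrC; congr (_%:E); congr (_ * _).
  by rewrite -cosN opprB addrC MsP.
rewrite integral_cos_gaussian_measure -EFinM; congr (_%:E).
rewrite /gauss_wave add0r mulmxDl cvdotDr VP (mulrDr 2^-1) (opprD (2^-1 * _)) expRD /e.
rewrite [M m + b]addrC (opprD b) addrA (cvdotBl (y - b)) MsP -[in RHS]cosN opprB.
by rewrite [X in cos X]addrC; ring.
Qed.

End gaussian_integral.

(** * Limits of matrices and block densities *)

Section matrix_limits.
Context {R : realType} {T : Type} (F : set_system T) {FF : ProperFilter F}.
Variables (p q : nat) (f : T -> 'M[R]_(p, q)) (l : 'M[R]_(p, q)).

Lemma cvg_mx : (forall i j, f x i j @[x --> F] --> (l i j : R)) -> f x @[x --> F] --> l.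
Proof.
move=> fl; apply/cvg_ballP => e e0.
have : \forall x \near F, forall i j, ball (l i j) e (f x i j).
  apply: filter_forall => i; apply: filter_forall => j.
  by move/cvg_ballP: (fl i j); apply.
by apply: filterS => x h; split.
Qed.

Lemma cvg_mx_lim : f x @[x --> F] --> l -> lim (f x @[x --> F]) = l.
Proof.
move=> fl; have fL : f x @[x --> F] --> lim (f x @[x --> F]) by exact: cvgP fl.
have coord (M : 'M[R]_(p, q)) i j : f x @[x --> F] --> M -> f x i j @[x --> F] --> (M i j : R).
  by move=> fM; exact: (@cvg_comp _ _ _ f (fun N => N i j) _ _ _ fM (@coord_continuous R p q i j M)).
apply/matrixP => i j.
exact: (cvg_unique _ (coord _ i j fL) (coord _ i j fl)).
Qed.

End matrix_limits.

Lemma pos_def_det_gt0 (R : realType) d (P : 'M[R]_d) : pos_def P -> 0 < \det P.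
Proof.
elim: d P => [|d IH] P Ppos; first by rewrite det_mx00 ltr01.
have [p [q [P' PE]]] := sym_block_mx Ppos.1.
rewrite PE in Ppos *; rewrite (schur_det Ppos) mulr_gt0//.
  exact: schur_pivot Ppos.
exact/IH/(schur_pos_def Ppos).
Qed.

Lemma gauss_density_block (R : realType) d e (y1 b1 : 'cV[R]_d) (y2 b2 : 'cV[R]_e)
    (A : 'M[R]_d) (B : 'M[R]_e) : pos_def A -> pos_def B ->
  gauss_density (col_mx y1 y2) (col_mx b1 b2) (block_mx A 0 0 B) =
  gauss_density y1 b1 A * gauss_density y2 b2 B.
Proof.
move=> Ap Bp; have Au := pos_def_unitmx Ap; have Bu := pos_def_unitmx Bp.
have ABu : block_mx A 0 0 B \in unitmx.
  by rewrite unitmxE det_ublock unitrM -!unitmxE Au.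
have invE : invmx (block_mx A 0 0 B) = block_mx (invmx A) 0 0 (invmx B).
  rewrite -[RHS](mulKmx ABu) mulmx_block !mulmxV// !mul0mx !mulmx0 !addr0 !add0r.
  by rewrite -scalar_mx_block mulmx1.
rewrite /gauss_density opp_col_mx add_col_mx invE mul_block_col !mul0mx addr0 add0r.
rewrite cvdot_col_mx mulrDr opprD expRD det_ublock exprD mulrACA sqrtrM; last first.
  by rewrite mulr_ge0// ?exprn_ge0 ?mulr_ge0 ?pi_ge0// ltW// pos_def_det_gt0.
by rewrite invfM mulrACA.
Qed.

(** * Bounded operators into column vectors *)

Section bounded_operators.
Context {R : realType} {H : completeNormedModType R}.
Variable ip : {dot H for idfun}.
Hypothesis hip : induces_norm ip.

(** Exactly what [adjointP] requires. It is stated for plain functions because [L_op] is a fixpoint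
    without linear structure; linearity is recovered from the functionals. *)
Definition bounded_operator d (M : H -> 'cV[R]_d) :=
  forall th, bounded_functional (fun x => cvdot (M x) th).

Lemma continuous_bounded_operator d (L : {linear H -> 'cV[R]_d}) :
  continuous L -> bounded_operator L.
Proof.
move=> Lc th; pose f x : R^o := cvdot (L x) th.
have flin : linear f.
  by move=> k x z; rewrite /f linearP cvdotDl cvdotZl.
pose fL : {linear H -> R^o} := HB.pack f (GRing.isLinear.Build _ _ _ _ f flin).
have fc : continuous fL.
  move=> x; rewrite /fL /= /f; under eq_fun do rewrite cvdotE.
  apply: cvg_big => [|i _]; first exact: add_continuous.
  apply: cvgM; last exact: cvg_cst.
  exact: (@cvg_comp _ _ _ L (fun N => N i 0) _ _ _ (Lc x) (@coord_continuous R d 1 i 0 (L x))).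
split; first exact: flin.
by have [C _ fC] := linear_bound fc; exists C.
Qed.

Lemma bounded_operator_linear d (M : H -> 'cV[R]_d) k x y :
  bounded_operator M -> M (k *: x + y) = k *: M x + M y.
Proof.
move=> Mb; apply/colP => i; rewrite -cvdot_delta.
by have [-> _] := Mb (delta_mx i 0); rewrite -!cvdot_delta cvdotDl cvdotZl.
Qed.

Lemma bounded_operator_comp d (M : H -> 'cV[R]_d) (T : {linear H -> H}) C :
  (forall x, `|T x| <= C * `|x|) -> bounded_operator M ->
  bounded_operator (fun x => M (T x)).
Proof.
move=> TC Mb th; have [Ml [K MK]] := Mb th; split.
  by move=> k x y; rewrite linearP Ml.
exists (`|K| * C) => x; apply: le_trans (MK _) _; rewrite -mulrA.
apply: le_trans (ler_wpM2r _ (ler_norm K)) _ => //.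
by apply: ler_wpM2l.
Qed.

Lemma bounded_operator_col_mx d e (M : H -> 'cV[R]_d) (N : H -> 'cV[R]_e) :
  bounded_operator M -> bounded_operator N ->
  bounded_operator (fun x => col_mx (M x) (N x)).
Proof.
move=> Mb Nb th; rewrite -[th]vsubmxK; under eq_fun do rewrite cvdot_col_mx.
have [Ml [C MC]] := Mb (usubmx th); have [Nl [D ND]] := Nb (dsubmx th).
split; first by move=> k x y; rewrite Ml Nl mulrDr addrACA.
exists (C + D) => x; rewrite mulrDl; apply: le_trans (ler_normD _ _) _.
exact: lerD.
Qed.

Section sandwich.
Variables (d : nat) (M : H -> 'cV[R]_d) (C : H -> H).
Hypothesis Mb : bounded_operator M.
Hypothesis C_sym : forall h k, ip (C h) k = ip (C k) h.
Local Notation Ms := (adjoint ip (@cvdot R d) M).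

Lemma cvdot_adjoint x th : cvdot (M x) th = ip x (Ms th).
Proof. exact: (adjointP hip (Mb th)). Qed.

Lemma sandwich_mxE i j :
  sandwich_mx ip M C i j = ip (C (Ms (delta_mx j 0))) (Ms (delta_mx i 0)).
Proof. by rewrite mxE -cvdot_delta cvdot_adjoint. Qed.

Lemma sandwich_mx_sym : (sandwich_mx ip M C)^T = sandwich_mx ip M C.
Proof. by apply/matrixP => i j; rewrite mxE !sandwich_mxE C_sym. Qed.

(** Neither [C] nor [Ms] comes with a proof of linearity. Symmetry of [C] first moves [th] to the
    right-hand slot, where [cvdot] is linear, and the expansion over coordinates takes place
    there. *)
Lemma sandwich_mx_quadratic th :
  cvdot th (sandwich_mx ip M C *m th) = ip (C (Ms th)) (Ms th).
Proof.
rewrite -cvdot_adjoint cvdotC; congr cvdot; apply/colP => i; rewrite mxE.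
rewrite -[RHS]cvdot_delta [RHS]cvdot_adjoint C_sym -cvdot_adjoint cvdotE.
by apply: eq_bigr => j _; rewrite sandwich_mxE C_sym -cvdot_adjoint cvdot_delta.
Qed.

End sandwich.

End bounded_operators.

Section unit_mass.
Context d (T : measurableType d) (R : realType) (mu : {measure set T -> \bar R}).
Hypothesis mu1 : mu setT = 1%E.

(** A kernel value is a plain measure of total mass 1. This alias keeps the proof of that fact as an
    argument, so that the probability structure can be attached to it. *)
Definition unit_mass of mu setT = 1%E : set T -> \bar R := mu.

HB.instance Definition _ := Measure.copy (unit_mass mu1) mu.
HB.instance Definition _ := @Measure_isProbability.Build _ _ _ (unit_mass mu1) mu1.

End unit_mass.

Lemma gaussian_measure_density_integral (R : realType) (H : completeNormedModType R)
    (ip : {dot H for idfun}) (hip : induces_norm ip)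
    (mu : {measure set (borel H) -> \bar R}) (mu1 : mu setT = 1%E)
    (m : H) (C : H -> H) (hmu : gaussian_measure ip mu m C)
    (C_sym : forall h k, ip (C h) k = ip (C k) h) (C_ge0 : forall h, 0 <= ip (C h) h)
    d (M : H -> 'cV[R]_d) (Mb : bounded_operator M) (P : 'M[R]_d) (y b : 'cV[R]_d) :
  pos_def P ->
  (\int[mu]_u (gauss_density y (M u + b) P)%:E)%E =
  (gauss_density y (M m + b) (P + sandwich_mx ip M C))%:E.
Proof.
move=> Pp.
have -> : mu = unit_mass mu1 by exact: eq_measure.
apply: (@gauss_density_integral _ _ _ hip (unit_mass mu1) m C hmu C_ge0 d M
  (adjoint ip (@cvdot R d) M)) => //.
- exact: cvdot_adjoint.
- exact: sandwich_mx_quadratic.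
- exact: sandwich_mx_sym.
Qed.

(** * The backward recursion *)

Section smoothing.
Context {R : realType} {H : completeNormedModType R}.
Variable ip : {dot H for idfun}.
Hypothesis hip : induces_norm ip.
Variable S : R -> {linear H -> H}.
Hypothesis hS : C0_semigroup S.
Variable Q : {linear H -> H}.
Hypothesis Qc : continuous Q.
Hypothesis Q_sym : forall x y : H, ip (Q x) y = ip x (Q y).
Hypothesis Q_pos : forall x : H, 0 <= ip (Q x) x.
Variable a : R -> H.
Hypothesis a_int : forall b, 0 <= b ->
  bochner_integrable (@lebesgue_measure R) `[0, b] a.

Lemma sandwich_mx_cvg d (M : H -> 'cV[R]_d) K s0 t : bounded_operator M -> s0 < t ->
  K + sandwich_mx ip M (cov_int ip S Q (t - s)) @[s --> s0^'+] -->
  K + sandwich_mx ip M (cov_int ip S Q (t - s0)).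
Proof.
move=> Mb s0t; apply: cvg_mx => i j.
under eq_fun do rewrite mxE (sandwich_mxE hip _ Mb).
rewrite mxE (sandwich_mxE hip _ Mb); apply: cvgD; first exact: cvg_cst.
exact: (cov_int_cvg hip hS Qc).
Qed.

Lemma drift_int_operator_cvg d (M : H -> 'cV[R]_d) K s0 t :
  bounded_operator M -> 0 <= s0 -> s0 < t ->
  K + M (drift_int S a s t) @[s --> s0^'+] --> K + M (drift_int S a s0 t).
Proof.
move=> Mb s00 s0t; apply: cvg_mx => i j; rewrite (ord1 j).
under eq_fun do rewrite mxE -(cvdot_delta (M _)) (cvdot_adjoint hip Mb).
rewrite mxE -(cvdot_delta (M _)) (cvdot_adjoint hip Mb).
apply: cvgD; first exact: cvg_cst.
exact: (drift_int_cvg hip hS a_int).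
Qed.

Variables (n : nat) (tau : nat -> R) (m : nat) (L : {linear H -> 'cV[R]_m}).
Hypothesis tau0 : tau 0%N = 0.
Hypothesis tauS : forall i : nat, (i < n)%N -> tau i < tau i.+1.
Hypothesis Lc : continuous L.
Variable Sigma : 'M[R]_m.
Hypothesis Sigma_pos : pos_def Sigma.
Local Notation L_op := (L_op S L n tau).
Local Notation R_mx := (R_mx ip S Q L Sigma n tau).
Local Notation alpha_vec := (alpha_vec S a L n tau).

Lemma tau_le i j : (i <= j <= n)%N -> tau i <= tau j.
Proof.
elim: j => [|j IH]; first by rewrite leqn0 => /andP[/eqP-> _].
move=> /andP[]; rewrite leq_eqVlt => /predU1P[->//|ij jn].
by rewrite (le_trans (IH _))// ?[(_ <= j)%N]ij ?(ltnW jn)// ltW// tauS.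
Qed.

Lemma tau_ge0 i : (i <= n)%N -> 0 <= tau i.
Proof. by move=> i_n; rewrite -tau0 tau_le. Qed.

Lemma tau_ltS r : (r < n)%N -> tau (n - r.+1) < tau (n - r).
Proof. by move=> rn; rewrite -(subnSK rn) tauS// ltn_subrL (leq_ltn_trans (leq0n r) rn). Qed.

Lemma semigroup0 x : S 0 x = x.
Proof. by have [_ -> _ _] := hS. Qed.

Lemma semigroupD s t x : 0 <= s -> 0 <= t -> S s (S t x) = S (s + t) x.
Proof. by move=> s0 t0; have [_ _ -> // _] := hS. Qed.

(** The time tau (n - r) is the earliest one in the stack, so the bound on [t] keeps all semigroup
    times nonnegative. *)
Lemma L_op_bounded r t : (r <= n)%N -> t <= tau (n - r) -> bounded_operator (L_op r t).
Proof.
have piece s : 0 <= s -> bounded_operator (fun x => L (S s x)).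
  move=> s0; have [C _ SC] := semigroup_bounded hS s.
  apply: (bounded_operator_comp (C := C)) (continuous_bounded_operator Lc) => x.
  by apply: SC; rewrite s0 lexx.
elim: r => [|r IH] rn tr; first by apply: piece; rewrite subn0 in tr; lra.
apply: bounded_operator_col_mx; first by apply: piece; lra.
by apply: IH (ltnW rn) (le_trans tr (ltW _)); exact: tau_ltS.
Qed.

Lemma L_op_semigroup r s t x : (r <= n)%N -> s <= t -> t <= tau (n - r) ->
  L_op r t (S (t - s) x) = L_op r s x.
Proof.
have SE u : s <= t -> t <= u -> S (u - t) (S (t - s) x) = S (u - s) x.
  by move=> st tu; rewrite semigroupD ?subr_ge0// addrA subrK.
elim: r => [|r IH] rn st tr /=; first by rewrite SE// -[n]subn0.
rewrite SE// IH//; first exact: ltnW.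
by apply: le_trans tr (ltW _); exact: tau_ltS.
Qed.

(* [R_base] and [alpha_base] are the parts of the recursions that do not depend on
   [t], with the limits already replaced by values. *)
Definition R_base r : 'M[R]_(dim_plus m r) :=
  match r with
  | 0%N => Sigma
  | r'.+1 => block_mx Sigma 0 0 (R_mx r' (tau (n - r'.+1)))
  end.

Definition alpha_base r : 'cV[R]_(dim_plus m r) :=
  match r with
  | 0%N => 0
  | r'.+1 => col_mx 0 (alpha_vec r' (tau (n - r'.+1)))
  end.

Lemma L_op0 : L_op 0 (tau n) = L.
Proof. by apply/funext => x /=; rewrite subrr semigroup0. Qed.

(** The limit inside the recursion does not depend on [s], so only the sandwich term moves and no
    induction on [r] is involved. *)
Lemma R_mx_cvg r s0 : (r <= n)%N -> s0 < tau (n - r) ->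
  R_mx r s @[s --> s0^'+] --> R_mx r s0.
Proof.
case: r => [|r] rn s0t.
  apply: sandwich_mx_cvg; first exact: continuous_bounded_operator.
  by rewrite subn0 in s0t.
by apply: sandwich_mx_cvg => //; exact: L_op_bounded.
Qed.

Lemma alpha_vec_cvg r s0 : (r <= n)%N -> 0 <= s0 -> s0 < tau (n - r) ->
  alpha_vec r s @[s --> s0^'+] --> alpha_vec r s0.
Proof.
case: r => [|r] rn s00 s0t.
  have := @drift_int_operator_cvg _ L 0 s0 (tau n) (continuous_bounded_operator Lc) s00.
  under eq_fun do rewrite add0r; rewrite add0r; apply.
  by rewrite subn0 in s0t.
by apply: drift_int_operator_cvg => //; exact: L_op_bounded.
Qed.

Lemma R_mxE r t : (r <= n)%N ->
  R_mx r t = R_base r + sandwich_mx ip (L_op r (tau (n - r))) (cov_int ip S Q (tau (n - r) - t)).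
Proof.
case: r => [|r] rn; first by rewrite subn0 L_op0.
rewrite /= (cvg_mx_lim (R_mx_cvg (ltnW rn) (tau_ltS rn))) //.
Qed.

Lemma alpha_vecE r t : (r <= n)%N ->
  alpha_vec r t = alpha_base r + L_op r (tau (n - r)) (drift_int S a t (tau (n - r))).
Proof.
case: r => [|r] rn; first by rewrite subn0 L_op0 add0r.
rewrite /= (cvg_mx_lim (alpha_vec_cvg (ltnW rn) (tau_ge0 (leq_subr _ _)) (tau_ltS rn))) //.
Qed.

Lemma pos_def_R_mx r t : (r <= n)%N -> pos_def (R_base r) -> pos_def (R_mx r t).
Proof.
move=> rn Bp; have Mb := L_op_bounded rn (lexx (tau (n - r))); rewrite R_mxE//.
have C_sym := cov_int_sym hip hS Qc Q_sym (tau (n - r) - t).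
apply: pos_defD_psd => //; first exact: (sandwich_mx_sym hip Mb).
move=> u; rewrite (sandwich_mx_quadratic hip Mb)//.
exact: (cov_int_ge0 hip hS Qc Q_pos).
Qed.

Lemma pos_def_R_base r : (r <= n)%N -> pos_def (R_base r).
Proof.
elim: r => [//|r IH] rn; apply: pos_def_block => //.
apply: pos_def_R_mx; first exact: ltnW.
exact/IH/ltnW.
Qed.

Variable nu : R -> R -> R.-pker (borel H) ~> (borel H).
Hypothesis hnu : ou_kernel ip S Q a nu.
Variable y : nat -> 'cV[R]_m.
Local Notation path_integral := (path_integral L Sigma n tau y nu).

Lemma integral_L_op_density r t x : (r <= n)%N -> 0 <= t -> t <= tau (n - r) ->
  (\int[nu t (tau (n - r)) x]_u (gauss_density (y_plus n y r)
     (L_op r (tau (n - r)) u + alpha_base r) (R_base r))%:E)%E =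
  (gauss_density (y_plus n y r) (L_op r t x + alpha_vec r t) (R_mx r t))%:E.
Proof.
move=> rn t0 tr; have Mb := L_op_bounded rn (lexx (tau (n - r))).
have meanE : L_op r (tau (n - r)) (S (tau (n - r) - t) x + drift_int S a t (tau (n - r))) +
    alpha_base r = L_op r t x + alpha_vec r t.
  have := bounded_operator_linear 1 (S (tau (n - r) - t) x) (drift_int S a t (tau (n - r))) Mb.
  rewrite !scale1r => ->; rewrite L_op_semigroup// -addrA alpha_vecE//.
  by rewrite [X in _ + X = _]addrC.
rewrite (gaussian_measure_density_integral hip (@prob_kernel _ _ _ _ _ (nu t (tau (n - r))) x) (hnu x t0 tr)) //.
- by rewrite meanE -R_mxE.
- by move=> h k; exact: (cov_int_sym hip hS Qc Q_sym).
- by move=> h; exact: (cov_int_ge0 hip hS Qc Q_pos).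
- exact: pos_def_R_base.
Qed.

Lemma path_integralE r u : (r < n)%N ->
  path_integral r u = (gauss_density (y_plus n y r)
     (L_op r (tau (n - r)) u + alpha_base r) (R_base r))%:E.
Proof.
elim: r u => [|r IH] u rn; first by rewrite subn0 L_op0 addr0.
have r_n := ltnW rn.
(* The values of R and alpha at this observation time are the lower blocks of [R_base r.+1] and
   [alpha_base r.+1], so the product is a single block density. *)
transitivity ((gauss_density (y (n - r.+1)%N) (L u) Sigma)%:E *
  (gauss_density (y_plus n y r) (L_op r (tau (n - r.+1)) u + alpha_vec r (tau (n - r.+1)))
     (R_mx r (tau (n - r.+1))))%:E)%E.
  rewrite -integral_L_op_density ?(ltnW r_n) ?tau_ge0 ?leq_subr ?ltW ?tau_ltS//.
  transitivity ((gauss_density (y (n - r.+1)%N) (L u) Sigma)%:E *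
    \int[nu (tau (n - r.+1)) (tau (n - r)) u]_v path_integral r v)%E; first exact: erefl.
  by congr *%E; apply: eq_integral => v _; rewrite IH.
have Rp : pos_def (R_mx r (tau (n - r.+1))).
  by apply: pos_def_R_mx; [|apply: pos_def_R_base]; exact: ltnW.
rewrite -EFinM -gauss_density_block//.
have -> : L_op r.+1 (tau (n - r.+1)) u + alpha_base r.+1 = col_mx (L u)
    (L_op r (tau (n - r.+1)) u + alpha_vec r (tau (n - r.+1))).
  by rewrite [LHS]add_col_mx addr0 subrr semigroup0.
exact: erefl.
Qed.

Lemma integral_path_integral r t x : (r < n)%N -> 0 <= t -> t <= tau (n - r) ->
  (\int[nu t (tau (n - r)) x]_u path_integral r u)%E =
  (gauss_density (y_plus n y r) (L_op r t x + alpha_vec r t) (R_mx r t))%:E.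
Proof.
move=> rn t0 tr; rewrite -integral_L_op_density//; last exact: ltnW.
by apply: eq_integral => u _; rewrite path_integralE.
Qed.

Lemma obs_indexE i t : (1 <= i <= n)%N -> tau i.-1 < t <= tau i ->
  obs_index n tau t = i.
Proof.
move=> /andP[i1 i_n] /andP[it ti]; rewrite /obs_index.
have -> : n.+1 = (i + (n - i).+1)%N by rewrite addnS subnKC.
rewrite iotaD find_cat size_iota.
have -> : has (fun j => t <= tau j) (iota 0 i) = false.
  apply/negbTE/hasPn => j; rewrite mem_iota add0n => /andP[_ ji].
  rewrite -ltNge (le_lt_trans _ it)// tau_le// (leq_trans (leq_pred i) i_n) andbT.
  by rewrite -ltnS prednK.
by rewrite /= add0n ti addn0.
Qed.

Lemma g_fun_gauss_density i t x : (1 <= i <= n)%N -> tau i.-1 < t <= tau i ->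
  g_fun L Sigma n tau y nu t x =
  (gauss_density (y_plus n y (n - i)) (L_op (n - i) t x + alpha_vec (n - i) t)
     (R_mx (n - i) t))%:E.
Proof.
move=> hi ht; have [/andP[i1 i_n] /andP[it ti]] := (hi, ht).
(* Hence the branch of [g_fun] defined by a limit at time 0 is not taken. *)
have t0 : 0 < t.
  by apply: le_lt_trans it; rewrite tau_ge0// (leq_trans (leq_pred i)).
have ni : (n - i < n)%N by rewrite ltn_subrL i1 (leq_trans i1).
rewrite /g_fun gt_eqF// (obs_indexE hi ht).
by rewrite -integral_path_integral ?subKn// ltW.
Qed.

End smoothing.

Unset Implicit Arguments.
Set Strict Implicit.

Theorem theorem2p6 (R : realType) (H : completeNormedModType R)
  (ip : {dot H for idfun}) (hip : induces_norm ip)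
  (domA : set H) (A : H -> H) (S : R -> {linear H -> H})
  (hS : C0_semigroup S) (hA : generates domA A S)
  (Q : {linear H -> H}) (hQ : sym_pos_trace_class ip Q)
  (d : measure_display) (Omega : measurableType d) (P : probability Omega R)
  (F : R -> set (set Omega)) (hF : filtration F)
  (a : R -> Omega -> H) (ha : predictable F a)
  (ha_int : forall (w : Omega) (T' : R), 0 <= T' ->
    bochner_integrable (@lebesgue_measure R) `[0, T'] (a ^~ w))
  (nu : Omega -> R -> R -> R.-pker (borel H) ~> (borel H))
  (hnu : forall w : Omega, ou_kernel ip S Q (a ^~ w) (nu w))
  (n : nat) (hn : (0 < n)%N) (T : R) (tau : nat -> R) (htau0 : tau 0%N = 0)
  (htau : forall i : nat, (i < n)%N -> tau i < tau i.+1) (hT : tau n = T)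
  (m : nat) (hm : (0 < m)%N)
  (L : {linear H -> 'cV[R]_m}) (hL : continuous L)
  (Sigma : 'M[R]_m) (hSigma : pos_def Sigma)
  (y : nat -> 'cV[R]_m) :
  forall (w : Omega) (x : H) (i : nat) (t : R),
    (1 <= i <= n)%N -> tau i.-1 < t <= tau i ->
    g_fun L Sigma n tau y (nu w) t x =
    (gauss_density (y_plus n y (n - i))
       (L_op S L n tau (n - i) t x + alpha_vec S (a ^~ w) L n tau (n - i) t)
       (R_mx ip S Q L Sigma n tau (n - i) t))%:E.
Proof.
case: hQ => Qc Q_sym Q_pos _ w x i t hi ht.
exact: (g_fun_gauss_density hip hS Qc Q_sym Q_pos (ha_int w) htau0 htau hL hSigma (hnu w)).
Qed.
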